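(* Let $d\ge1$, $\sigma\in\mathbb R$, and for $\delta\in(0,1]$ let $(X^\delta_{n\delta})_{n\ge0}$ be the modified Euler scheme $$X_{(n+1)\delta}^\delta=\pi^{(\delta)}(X_{n\delta}^\delta)+b^{(\delta)}(\pi^{(\delta)}(X_{n\delta}^\delta))\delta+\sigma\big(W_{(n+1)\delta}-W_{n\delta}\big).$$ Assume: (a) $\pi^{(\delta)}(0)=0$ and $|\pi^{(\delta)}(x)-\pi^{(\delta)}(y)|\le|x-y|$ for all $x,y\in\mathbb R^d$. (b) There exist constants $R,C_R,K_R,K_R^*>0$, $\theta\in[0,1/2)$ and $\delta_R\in(0,1]$ such that for all $\delta\in(0,\delta_R]$ and $x,y\in\mathbb R^d$, $$\big|b^{(\delta)}(\pi^{(\delta)}(x))-b^{(\delta)}(\pi^{(\delta)}(y))\big|\le\begin{cases}C_R|x-y|,&|x|\le R,\ |y|\le R,\\ K_R\delta^{-\theta}|x-y|,&|x|>R\text{ or }|y|>R,\end{cases}$$ and, whenever $|x|>R$ or $|y|>R$, $$\big\langle\pi^{(\delta)}(x)-\pi^{(\delta)}(y),b^{(\delta)}(\pi^{(\delta)}(x))-b^{(\delta)}(\pi^{(\delta)}(y))\big\rangle\le-K_R^*\big|\pi^{(\delta)}(x)-\pi^{(\delta)}(y)\big|^2 .$$ (c) For every $r>0$ there is $\delta_r^*\in(0,1]$ such that for all $\delta\in(0,\delta_r^*]$: $\inf_{|x|\ge r}|\pi^{(\delta)}(x)|\ge r$, and $|\pi^{(\delta)}(x)|=|x|$ for $|x|\le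 r$. In addition there are increasing positive functions $\psi_1,\psi_2$ on $[0,\infty)$ such that for all $\delta\in(0,1]$, $x\in\mathbb R^d$, $r\ge0$, $$\big|b^{(\delta)}(\pi^{(\delta)}(x))\big|\le\psi_1(r)+\psi_2(r)\delta^{-\theta}|\pi^{(\delta)}(x)|\mathbf 1_{\{|\pi^{(\delta)}(x)|>r\}} .$$ (d) With $R_0:=2\big((1+R)(1+96C_R/K_R^* )+\psi_1(1)\big)$, $$\sigma^2>\frac{8(1+R)}{dK_R^*}\Big(\big(3C_R(K_R^*+96C_R)(1+R)\big)\vee\big(\psi_1(R)K_R^*\big)\vee\big(12C_R\psi_1(R_0)\big)\Big).$$ Set $$\lambda_1:=6C_R\sigma^2\Big(\sigma^2+\frac{24C_R(K_R^*+96C_R)(1+R)^2}{dK_R^*}\Big)^{-1}-3C_R,\qquad\lambda_2:=K_R^*/4,$$ $$C_0:=\Big(1+\frac{24C_R(K_R^*+96C_R)(1+R)^2}{dK_R^*\sigma^2}\Big)^{1/2},$$ $$\delta_1^\star:=\delta_R\wedge(2K_R^* )^{-1}\wedge(K_R^*/K_R^2)^{\frac1{1-2\theta}}\wedge\frac1{C_R}\wedge\frac1{\lambda_1}\wedge\frac1{\lambda_2}\wedge\delta_{R_0}^*\wedge(2\psi_2(1))^{\frac1{\theta-1}}\wedge\big(4(2+d)(1+R^2)\sigma^2\big)^{-1}.$$ Then for all $\delta\in(0,\delta_1^\star]$, all integers $n\ge0$ and all $\mu,\nu\in\mathscr P_2(\mathbb R^d)$, $$\mathbb W_2\big(\mu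 P^{(\delta)}_{n\delta},\nu P^{(\delta)}_{n\delta}\big)\le C_0\,e^{-\frac12(\lambda_1\wedge\lambda_2)n\delta}\,\mathbb W_2(\mu,\nu).$$
   Context: $(W_t)_{t\ge0}$ is a $d$-dimensional Brownian motion on a complete filtered probability space $(\Omega,\mathscr F,(\mathscr F_t),\mathbb P)$; the initial value $X_0^\delta$ is $\mathscr F_0$-measurable. For each $\delta$, $b^{(\delta)},\pi^{(\delta)}:\mathbb R^d\to\mathbb R^d$ are measurable; they are modified versions of a measurable drift $b:\mathbb R^d\to\mathbb R^d$ and of the identity, i.e. for each fixed $x$, $|b^{(\delta)}(x)-b(x)|\to0$ and $|\pi^{(\delta)}(x)-x|\to0$ as $\delta\to0$ (the scheme discretizes $\mathrm dX_t=b(X_t)\mathrm dt+\sigma\,\mathrm dW_t$). $|\cdot|$, $\langle\cdot,\cdot\rangle$: Euclidean norm and inner product; $\vee,\wedge$: max, min. $\mathscr P_2(\mathbb R^d)$: Borel probability measures with finite second moment; $\mathbb W_2$: $L^2$-Wasserstein distance. $\mu P^{(\delta)}_{n\delta}$ is the law of $X^\delta_{n\delta}$ when $X_0^\delta$ has law $\mu$. Under (d) one has $\lambda_1>0$. *)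

(* Defs.v *)
From HB Require Import structures.
From mathcomp Require Import all_boot all_order all_algebra.
From mathcomp Require Import all_classical all_reals all_analysis.

Set Implicit Arguments.
Unset Strict Implicit.
Unset Printing Implicit Defensive.

Import Order.TTheory GRing.Theory Num.Theory.
Import numFieldNormedType.Exports.

Local Open Scope classical_set_scope.
Local Open Scope ring_scope.

(* The library has no sigma-algebra on row vectors: equip 'rV[R]_d with the
   Borel sigma-algebra. *)
Section borel_row_vector.
Context (R : realType) (d : nat).

HB.instance Definition _ := @isMeasurable.Build
  (sigma_display (@open 'rV[R]_d)) 'rV[R]_d
  (<<s @open 'rV[R]_d >>)
  (@sigma_algebra0 _ setT (@open 'rV[R]_d))
  (@sigma_algebraC _ (@open 'rV[R]_d))
  (@sigma_algebra_bigcup _ setT (@open 'rV[R]_d)).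

End borel_row_vector.

Section euclidean.
Context {R : realType} {d : nat}.
Implicit Types x y : 'rV[R]_d.

Definition dotp x y : R := \sum_(i < d) x 0 i * y 0 i.

(* Not `|x|, which is the sup norm on row vectors. *)
Definition enorm x : R := Num.sqrt (dotp x x).

End euclidean.

Section wasserstein.
Context {R : realType} {d : nat}.
Implicit Types mu nu : probability 'rV[R]_d R.

(* Membership in P_2(R^d). *)
Definition finite_second_moment mu : Prop :=
  (\int[mu]_x (enorm x ^+ 2)%:E < +oo)%E.

Definition coupling mu nu
    (g : probability ('rV[R]_d * 'rV[R]_d)%type R) : Prop :=
  (forall A, measurable A -> g (A `*` setT) = mu A) /\
  (forall B, measurable B -> g (setT `*` B) = nu B).

Definition W2 mu nu : \bar R :=
  ereal_inf [set ((\int[g]_z (enorm (z.1 - z.2) ^+ 2)%:E) `^ 2^-1)%E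
            | g in coupling mu nu].

End wasserstein.

Section brownian.
Context {R : realType} {d : nat}.
Context {dO : measure_display} {Omega : measurableType dO}.
Variable P : probability Omega R.

Definition measurable_wrt (G : set (set Omega)) (f : Omega -> 'rV[R]_d) :=
  forall A, measurable A -> G (f @^-1` A).

(* Times are the nonnegative reals; values at negative times are irrelevant.
   The last clause includes the completeness of P, since F 0 `<=` measurable. *)
Definition complete_filtration (F : R -> set (set Omega)) : Prop :=
  [/\ forall t, 0 <= t -> sigma_algebra setT (F t),
      forall t, 0 <= t -> F t `<=` measurable,
      forall s t, 0 <= s -> s <= t -> F s `<=` F t
    & forall A, P.-negligible A -> F 0 A].

(* Standard d-dimensional Brownian motion relative to F: for s < t the
   increment W t - W s is independent of F s with law N(0, (t - s) Id), the
   latter expressed on measurable rectangles (normal_prob takes the standard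
   deviation). *)
Definition brownian_motion (F : R -> set (set Omega))
    (W : R -> Omega -> 'rV[R]_d) : Prop :=
  [/\ {ae P, forall w, W 0 w = 0},
      {ae P, forall w, {within `[0, +oo[, continuous (fun t => W t w)}},
      forall t, 0 <= t -> measurable_wrt (F t) (W t),
      forall s t, 0 <= s -> s < t -> forall A B, F s A -> measurable B ->
        P (A `&` [set w | B (W t w - W s w)]) =
        (P A * P [set w | B (W t w - W s w)%R])%E
    & forall s t, 0 <= s -> s < t ->
        forall B : 'I_d -> set R, (forall i, measurable (B i)) ->
        P [set w | forall i, B i ((W t w - W s w) 0 i)] =
        (\prod_(i < d) normal_prob 0%R (Num.sqrt (t - s)%R) (B i))%E].

(* X n w stands for the value of the scheme at time n * delta. *)
Definition modified_euler (pid bd : 'rV[R]_d -> 'rV[R]_d) (sigma delta : R)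
    (W : R -> Omega -> 'rV[R]_d) (X : nat -> Omega -> 'rV[R]_d) : Prop :=
  forall n w, X n.+1 w =
    pid (X n w) + delta *: bd (pid (X n w))
    + sigma *: (W (n.+1%:R * delta) w - W (n%:R * delta) w).

Definition has_law (X : Omega -> 'rV[R]_d) (mu : probability 'rV[R]_d R) :=
  forall A, measurable A -> P (X @^-1` A) = mu A.

End brownian.

(* m = mu P_{n delta}: m is the law at step n of the scheme started from a
   random variable of law mu. No particular stochastic basis is singled out:
   the predicate accepts every basis carrying a suitable initial value, so that
   no law mu is excluded because F 0 is too small. *)
Definition euler_law {R : realType} {d : nat}
    (pid bd : 'rV[R]_d -> 'rV[R]_d) (sigma delta : R) (n : nat)
    (mu m : probability 'rV[R]_d R) : Prop :=
  exists (dO : measure_display) (Omega : measurableType dO)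
    (P : probability Omega R) (F : R -> set (set Omega))
    (W : R -> Omega -> 'rV[R]_d) (X : nat -> Omega -> 'rV[R]_d),
  [/\ complete_filtration P F /\ brownian_motion P F W,
      measurable_wrt (F 0) (X 0%N),
      modified_euler pid bd sigma delta W X,
      has_law P (X 0%N) mu
    & has_law P (X n) m].

(* Main.v *)
Require Import Defs.
From mathcomp Require Import all_boot all_order all_algebra.
From mathcomp Require Import all_classical all_reals all_analysis.
From mathcomp Require Import measurable_realfun ring lra.

Set Implicit Arguments.
Unset Strict Implicit.
Unset Printing Implicit Defensive.

Import Order.TTheory GRing.Theory Num.Theory.
Import numFieldNormedType.Exports.

Local Open Scope classical_set_scope.
Local Open Scope ring_scope.

(** The scheme is coupled synchronously: two copies driven by the same Brownian
    increments, so that one step maps the difference to a deterministic quantity.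
    If one of the points lies outside the ball of radius r, dissipativity
    contracts the squared distance by 1 - K_R' delta; if both lie inside, the
    squared distance grows at most by 1 + 3 C_R delta, and the noise must help.
    It does so through the weight
      w(x, y) = 1 + k (M - F x) + k (M - F y),   k = 12 C_R / (d sigma^2),
    where F x is |x|^2 near the ball and then bends down, at curvature at least
    - K_R' / (48 C_R), to the constant M = (1 + r)^2 (1 + 96 C_R / K_R').
    Inside the ball the noise raises F by at least d sigma^2 delta / 4 on
    average, which lowers w by 6 C_R delta; everywhere F loses at most
    K_R' d sigma^2 delta / (32 C_R), which costs at most 3/4 K_R' delta.
    Since 1 <= w <= C0^2, the expectation of |x - y|^2 w(x, y) contracts by
    1 - min(lambda1, lambda2) delta at each step. Both scheme laws are pushed
    through the same kernel because the law of a Brownian increment is determined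
    by its values on boxes, so the coupling can be propagated although the two
    laws may come from different stochastic bases. *)

(** * The capped square *)

Section capped_square.
Context {R : realFieldType} (rho L eta : R).
Hypotheses (rho_gt0 : 0 < rho) (L_gt0 : 0 < L) (etaL : eta * L = 2 * rho).
Implicit Types s t : R.

Let params : [/\ 0 < rho, 0 < L, 0 < eta & eta * L = 2 * rho].
Proof. by split => //; rewrite -(pmulr_lgt0 eta L_gt0) etaL mulr_gt0. Qed.

(* The square up to rho, then slope decreasing linearly at rate eta from 2 * rho
   to 0, constant from rho + L on; this is C^1 when eta * L = 2 * rho. *)
Definition capsq s : R :=
  Num.min s rho ^+ 2 + 2 * rho * Num.min (Num.max (s - rho) 0) L
  - eta / 2 * Num.min (Num.max (s - rho) 0) L ^+ 2.

Variant capsq_spec s : R -> Type :=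
| CapsqLow of s <= rho : capsq_spec s (s ^+ 2)
| CapsqMid of rho < s & s <= rho + L :
    capsq_spec s (rho ^+ 2 + 2 * rho * (s - rho) - eta / 2 * (s - rho) ^+ 2)
| CapsqHigh of rho + L < s : capsq_spec s (rho ^+ 2 + rho * L).

Lemma capsqP s : capsq_spec s (capsq s).
Proof.
have [rho0 L0 eta0 eL] := params.
rewrite /capsq; have [h1|h1] := leP s rho.
  by rewrite max_r ?subr_le0// min_l ?ltW// expr0n/= !mulr0 addr0 subr0; constructor 1.
rewrite max_l ?subr_ge0 1?ltW//.
have [h2|h2] := leP (s - rho) L; first by constructor 2 => //; rewrite -lerBlDl.
(* By [eta * L = 2 * rho], the quadratic loss at the end of the bend is [rho * L], half of the
   linear gain. *)
have -> : rho ^+ 2 + 2 * rho * L - eta / 2 * L ^+ 2 = rho ^+ 2 + rho * L.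
  have -> : eta / 2 * L ^+ 2 = eta * L * L / 2 by ring.
  by rewrite etaL; field.
by constructor 3; rewrite -ltrBrDl.
Qed.

Lemma capsq_small s : s <= rho -> capsq s = s ^+ 2.
Proof. by have [rho0 L0 eta0 eL] := params; case: capsqP => // *; lra. Qed.

Lemma capsq_large s : rho + L <= s -> capsq s = rho ^+ 2 + rho * L.
Proof.
have [rho0 L0 eta0 eL] := params; case: capsqP => // [?|h1 h2] ?; first lra.
have -> : s - rho = L by lra.
have -> : eta / 2 * L ^+ 2 = eta * L * L / 2 by ring.
  by rewrite etaL; field.
Qed.

(* A supporting line of the convex function capsq s + eta / 2 * s ^+ 2. *)
Lemma capsq_semiconvex s : 0 <= s -> exists a, [/\ 0 <= a,
  a <= 2 * s & forall t, 0 <= t ->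
    capsq s + a * (t - s) - eta / 2 * (t - s) ^+ 2 <= capsq t].
Proof.
have [rho0 L0 eta0 eL] := params.
move=> s0; case: (capsqP s) => [h|h1 h2|h].
(* In each region the slope [a] is the derivative of [capsq] at [s]: [2 * s], then
   [2 * rho - eta * (s - rho)], then 0. *)
- exists (2 * s); split => [||t t0]; [lra|lra|].
  have := sqr_ge0 (t - s); have := mulr_ge0 (ltW eta0) (sqr_ge0 (t - s)).
  have z0 : 0 <= rho - s by rewrite subr_ge0.
  have := sqr_ge0 (rho - s); have := mulr_ge0 (ltW eta0) (sqr_ge0 (rho - s)).
  case: capsqP => [_|h1 h2|h1]; first nra; have y0 : 0 <= t - rho by lra.
    have := mulr_ge0 z0 y0; have := mulr_ge0 (ltW eta0) (mulr_ge0 z0 y0).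
    nra.
  have := mulr_ge0 z0 y0; have := mulr_ge0 (ltW eta0) (mulr_ge0 z0 y0).
  have := mulr_ge0 (ltW eta0) (sqr_ge0 (t - rho - L)).
  (* Products such as [eta * L * t] are atoms for [lra], so [eta * L = 2 * rho] is supplied
     multiplied by each quantity that occurs. *)
  have := congr1 ( *%R^~ L) eL; have := congr1 ( *%R^~ t) eL.
  have := congr1 ( *%R^~ rho) eL; lra.
- exists (2 * rho - eta * (s - rho)); split => [||t t0]; [nra|nra|].
  case: capsqP => [h3|h3 h4|h3]; first by
    have := sqr_ge0 (rho - t); have := mulr_ge0 (ltW eta0) (sqr_ge0 (rho - t)); lra.
    lra.
  have := mulr_ge0 (ltW eta0) (sqr_ge0 (t - rho - L)).
  have := congr1 ( *%R^~ L) eL; have := congr1 ( *%R^~ t) eL.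
  have := congr1 ( *%R^~ rho) eL; lra.
- exists 0; split => [||t t0]; [lra|lra|].
  have := congr1 ( *%R^~ L) eL; have := congr1 ( *%R^~ t) eL.
  have := congr1 ( *%R^~ rho) eL; have := mulr_ge0 (ltW eta0) (sqr_ge0 (t - s)).
  case: capsqP => [h3|h3 h4|h3]; last lra.
    have w0 : 0 <= rho - t by lra. have s0' : 0 <= s - rho - L by lra.
    have p0 : 0 <= s + rho + L - 2 * t by lra.
    have := mulr_ge0 (ltW eta0) (mulr_ge0 s0' p0).
    have := sqr_ge0 (rho - t); have := mulr_ge0 (ltW eta0) (sqr_ge0 (rho - t)); lra.
  have s0' : 0 <= s - rho - L by lra.
  have p0 : 0 <= s + rho + L - 2 * t by lra.
  have := mulr_ge0 (ltW eta0) (mulr_ge0 s0' p0); lra.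
Qed.

(** The slope is nonnegative on all three pieces; [0 <= s] keeps away from the decreasing branch of
    the square. *)
Lemma capsq_homo s t : 0 <= s -> s <= t -> capsq s <= capsq t.
Proof.
have [rho0 L0 eta0 eL] := params.
move=> s0 st; have := congr1 ( *%R^~ L) eL.
have := congr1 ( *%R^~ rho) eL; have := congr1 ( *%R^~ t) eL.
have := congr1 ( *%R^~ s) eL.
case: (capsqP s) => [h|h1 h2|h]; case: (capsqP t) => [h3|h3 h4|h3]; try nra.
- have z0 : 0 <= rho - s by lra.
  have z1 : 0 <= rho + s by lra. have y0 : 0 <= t - rho by lra.
  have y1 : 0 <= 2 * L - (t - rho) by lra.
  have := mulr_ge0 z0 z1; have := mulr_ge0 (ltW eta0) (mulr_ge0 y0 y1); lra.
- have z0 : 0 <= t - s by lra.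
  have y1 : 0 <= 2 * L - (t - rho) - (s - rho) by lra.
  have := mulr_ge0 (ltW eta0) (mulr_ge0 z0 y1); lra.
- have := mulr_ge0 (ltW eta0) (sqr_ge0 (s - rho - L)); lra.
Qed.

Lemma capsq_ge0 s : 0 <= s -> 0 <= capsq s.
Proof.
move=> s0; apply: le_trans (capsq_homo (lexx 0) s0).
by rewrite capsq_small ?expr0n// ltW.
Qed.

Lemma capsq_le s : 0 <= s -> capsq s <= rho ^+ 2 + rho * L.
Proof.
move=> s0; rewrite -(@capsq_large (Num.max s (rho + L))); last first.
  by rewrite le_max lexx orbT.
by rewrite capsq_homo// le_max lexx.
Qed.

(** The slope is largest at [rho], where it equals [2 * rho]. *)
Lemma capsq_lip s t : 0 <= s -> s <= t ->
  capsq t - capsq s <= 2 * rho * (t - s).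
Proof.
have [rho0 L0 eta0 eL] := params.
move=> s0 st; have := congr1 ( *%R^~ L) eL.
have := congr1 ( *%R^~ rho) eL; have := congr1 ( *%R^~ t) eL.
have := congr1 ( *%R^~ s) eL.
case: (capsqP s) => [h|h1 h2|h]; case: (capsqP t) => [h3|h3 h4|h3]; try nra.
- have := sqr_ge0 (rho - s); have := mulr_ge0 (ltW eta0) (sqr_ge0 (t - rho)); lra.
- have x0 : 0 <= t - s by lra. have y0 : 0 <= t - rho + (s - rho) by lra.
  have := mulr_ge0 (ltW eta0) (mulr_ge0 x0 y0); lra.
- have x0 : 0 <= rho + L - s by lra. have y0 : 0 <= L + (s - rho) by lra.
  have z0 : 0 <= t - rho - L by lra.
  have := mulr_ge0 (ltW rho0) z0.
  have := mulr_ge0 (ltW eta0) (mulr_ge0 x0 y0); lra.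
Qed.

End capped_square.

(** * Moments of the normal law *)

Section integral_normal_prob.
Local Open Scope ereal_scope.
Context {R : realType} (m s : R).
Notation mu := (@lebesgue_measure R).
Notation nu := (normal_prob m s).

(** Change of variables produces the Radon-Nikodym derivative, which agrees almost everywhere with
    [normal_pdf] because both have the same integral over every measurable set. *)
Lemma ge0_integral_normal_prob (f : R -> \bar R) : measurable_fun setT f ->
  (forall x, 0 <= f x) ->
  \int[nu]_x f x = \int[mu]_x (f x * (normal_pdf m s x)%:E).
Proof.
move=> mf f0.
have dom := normal_prob_dominates m s.
rewrite -(Radon_Nikodym_SigmaFinite.change_of_variables dom)//.
have iD := Radon_Nikodym_SigmaFinite.f_integrable dom.
have mpdf : measurable_fun setT (fun x => (normal_pdf m s x)%:E).
  by apply/measurable_EFinP; exact: measurable_normal_pdf.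
apply: ae_eq_integral => //.
- by apply: emeasurable_funM => //; exact: measurable_int iD.
- exact: emeasurable_funM.
apply: ae_eqe_mul2l; apply: integral_ae_eq => // E _ mE.
by rewrite -Radon_Nikodym_SigmaFinite.f_integral.
Qed.

Lemma integrable_normal_prob (f : R -> R) : measurable_fun setT f ->
  mu.-integrable setT (fun x => (f x * normal_pdf m s x)%:E) ->
  nu.-integrable setT (EFin \o f).
Proof.
move=> mf /integrableP[_ fi]; apply/integrableP; split.
  exact/measurable_EFinP.
rewrite ge0_integral_normal_prob//; last first.
  by apply: measurableT_comp => //; exact/measurable_EFinP.
apply: le_lt_trans fi; rewrite le_eqVlt; apply/orP; left; apply/eqP.
apply: eq_integral => x _ /=.
by rewrite -EFinM normrM (ger0_norm (normal_pdf_ge0 _ _ _)).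
Qed.

Lemma integral_normal_prob (f : R -> R) : measurable_fun setT f ->
  mu.-integrable setT (fun x => (f x * normal_pdf m s x)%:E) ->
  \int[nu]_x (f x)%:E = \int[mu]_x (f x * normal_pdf m s x)%:E.
Proof.
move=> mf fi; rewrite integralE [RHS]integralE.
have mfE : measurable_fun setT (EFin \o f) by exact/measurable_EFinP.
rewrite !ge0_integral_normal_prob//; [|exact: measurable_funeneg|
  exact: measurable_funepos].
congr (_ - _); apply: eq_integral => x _.
  rewrite !funeposE /= -!EFin_max -EFinM.
  by rewrite maxr_pMl ?mul0r// normal_pdf_ge0.
rewrite !funenegE /= -!EFin_max -EFinM.
by rewrite maxr_pMl ?mul0r ?mulNr// normal_pdf_ge0.
Qed.

End integral_normal_prob.

(** The fundamental theorem of calculus on [-n, n], then dominated convergence with bound |f|. This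
    is integration by parts for the Gaussian moments. *)
Lemma integral_derivative_eq0 {R : realType} (F f : R -> R) :
  (forall x, is_derive x (1 : R) F (f x)) -> continuous f ->
  (@lebesgue_measure R).-integrable setT (EFin \o f) ->
  F n%:R @[n --> \oo] --> (0 : R) -> F (- n%:R) @[n --> \oo] --> (0 : R) ->
  (\int[@lebesgue_measure R]_x (f x)%:E = 0)%E.
Proof.
move=> dF cf fi Fy FNy; set mu := @lebesgue_measure R.
pose f_ n := (EFin \o f) \_ `[(- n%:R)%R, n%:R].
have mf : measurable_fun setT (EFin \o f) by exact: measurable_int fi.
have mf_ n : measurable_fun setT (f_ n).
  by apply/(measurable_restrictT _ _).1 => //; exact: measurable_funTS.
have [|||_ _ cvgI] := @dominated_convergence _ _ _ mu setT measurableT f_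
  (EFin \o f) (abse \o (EFin \o f)) mf_ mf.
- apply/aeW => x _; apply: cvg_near_cst.
  near=> n; rewrite /f_ patchE mem_set//= in_itv/=.
  rewrite -ler_norml; near: n; exact: nbhs_infty_ger.
- by apply: integrable_abse.
- apply/aeW => x n _; rewrite /f_ patchE; case: ifPn => //= _.
  by rewrite normr0 lee_fin.
have <- : limn (fun n => (F n%:R - F (- n%:R))%:E) = 0%E.
  apply/cvg_lim => //; apply: cvg_EFin; first exact: nearW.
  by rewrite -[X in _ --> X](subrr (0 : R)); exact: cvgB.
apply/esym/cvg_lim => //; apply: cvg_trans cvgI; apply: near_eq_cvg.
near=> n; rewrite /= -integral_mkcond (@continuous_FTC2 _ f F)//.
- by rewrite gtrN// ltr0n; near: n; exists 1%N.
- by apply: continuous_subspaceT.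
- split.
  + by move=> x _; have [] := dF x.
  + apply: cvg_at_right_filter; apply: differentiable_continuous.
    apply/derivable1_diffP; by have [] := dF (- n%:R).
  + apply: cvg_at_left_filter; apply: differentiable_continuous.
    apply/derivable1_diffP; by have [] := dF n%:R.
- move=> x _; rewrite derive1E; exact: (@derive_val _ _ _ _ _ _ _ (dF x)).
Unshelve. all: by end_near. Qed.

Section normal_moments.
Context {R : realType} (s : R).
Hypothesis s_gt0 : 0 < s.
Notation mu := (@lebesgue_measure R).
Notation p := (normal_pdf 0 s).
Notation s' := (Num.sqrt 2 * s).

Let s_neq0 : s != 0. Proof. by rewrite gt_eqF. Qed.
Let s'_neq0 : s' != 0. Proof. by rewrite mulf_neq0// gt_eqF// sqrtr_gt0. Qed.

Let pE x : p x = normal_peak s * expR (- x ^+ 2 / (2 * s ^+ 2)).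
Proof. by rewrite normal_pdfE// /normal_fun subr0 mulr_natl. Qed.

Let K := 64 * s ^+ 4 * normal_peak s / normal_peak s'.

(* Trading the fourth power for the density of twice the variance makes the
   moments integrable and the boundary terms vanish. *)
Let expr4_pdf_le x : x ^+ 4 * p x <= K * normal_pdf 0 s' x.
Proof.
rewrite pE normal_pdfE// /normal_fun subr0 /K.
have -> : s' ^+ 2 *+ 2 = 4 * s ^+ 2.
  by rewrite exprMn sqr_sqrtr// -mulr_natl; ring.
have b0 : normal_peak s' != 0 by rewrite gt_eqF// normal_peak_gt0.
have -> : 64 * s ^+ 4 * normal_peak s / normal_peak s' *
    (normal_peak s' * expR (- x ^+ 2 / (4 * s ^+ 2))) =
    normal_peak s * (64 * s ^+ 4 * expR (- x ^+ 2 / (4 * s ^+ 2))) by field.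
rewrite mulrCA ler_wpM2l ?normal_peak_ge0//.
(* In this variable the density decays like exp(-4y) and the target like exp(-2y); the spare
   exp(-2y) absorbs y^2, since y <= exp(y). *)
pose y := x ^+ 2 / (8 * s ^+ 2).
have y0 : 0 <= y 
  by rewrite divr_ge0 ?sqr_ge0 // mulr_ge0 ?ler0n ?sqr_ge0.
have -> : x ^+ 4 = 64 * s ^+ 4 * y ^+ 2 by rewrite /y; field.
have -> : - x ^+ 2 / (2 * s ^+ 2) = - y *+ 2 + - y *+ 2 by rewrite /y; field.
have -> : - x ^+ 2 / (4 * s ^+ 2) = - y *+ 2 by rewrite /y; field.
set e := expR (- y *+ 2).
have e0 : 0 <= e by exact: expR_ge0.
have ye : y ^+ 2 * e <= 1.
  rewrite /e mulNrn expRN -mulr_natl expRM_natl.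
  rewrite ler_pdivrMr ?mul1r ?exprn_gt0 ?expR_gt0// lerXn2r ?nnegrE ?expR_ge0//.
  by apply: le_trans (expR_ge1Dx y); rewrite lerDr.
rewrite expRD -/e.
have -> : 64 * s ^+ 4 * y ^+ 2 * (e * e) = 64 * s ^+ 4 * e * (y ^+ 2 * e) by ring.
by rewrite ler_piMr// mulr_ge0// mulr_ge0// exprn_ge0// ltW.
Qed.

Let K_ge0 : 0 <= K.
Proof.
by rewrite divr_ge0 ?normal_peak_ge0// mulr_ge0 ?normal_peak_ge0// mulr_ge0//
  exprn_ge0// ltW.
Qed.

(** For k <= 4, |x|^k <= 1 + x^4, and both resulting terms are dominated by multiples of Gaussian
    densities. *)
Lemma integrable_expr_normal_pdf k : (k <= 4)%N ->
  mu.-integrable setT (fun x => (x ^+ k * p x)%:E).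
Proof.
move=> k4.
apply: (@le_integrable _ _ _ mu setT measurableT _
    (fun x => (p x + K * normal_pdf 0 s' x)%:E)).
- apply/measurable_EFinP/measurable_funM; last exact: measurable_normal_pdf.
  exact: measurable_funX.
- move=> x _ /=; rewrite lee_fin normrM (ger0_norm (normal_pdf_ge0 _ _ _)).
  rewrite [leRHS]ger0_norm; last first.
    by apply: addr_ge0; [|apply: mulr_ge0]; rewrite ?normal_pdf_ge0.
  apply: (@le_trans _ _ ((1 + x ^+ 4) * p x)); last first.
    by rewrite mulrDl mul1r lerD2l expr4_pdf_le.
  rewrite ler_wpM2r ?normal_pdf_ge0// normrX.
  have -> : x ^+ 4 = `|x| ^+ 4 by rewrite -normrX ger0_norm// exprn_even_ge0.
  have [x1|x1] := leP `|x| 1.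
    by apply: (@le_trans _ _ 1); [exact: exprn_ile1|rewrite lerDl exprn_ge0].
  by apply: (@le_trans _ _ (`|x| ^+ 4)); rewrite ?lerDr// ler_weXn2l// ltW.
- rewrite (_ : (fun x => _) = (fun x => (p x)%:E) \+
      (fun x => K%:E * (normal_pdf 0 s' x)%:E)%E); last first.
    by apply/funext => x; rewrite /= EFinD EFinM.
  apply: integrableD => //; first exact: integrable_normal_pdf.
  by apply: integrableZl => //; exact: integrable_normal_pdf.
Qed.

Let is_derive_pdf (x : R) : is_derive x (1 : R) p (- x / s ^+ 2 * p x).
Proof.
have -> : p = normal_peak s \*: (expR \o ((- (2 * s ^+ 2)^-1) \*: (id : R -> R) ^+ 2)).
  apply/funext => y; rewrite pE /= /GRing.scale/= exprfctE; congr (_ * expR _).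
  by rewrite mulrC mulNr mulrN.
apply: is_derive_eq.
rewrite /= /GRing.scale/= exprfctE; field.
by rewrite s_neq0.
Qed.

Let is_derive_expr_pdf k (x : R) : is_derive x (1 : R) (fun y => y ^+ k.+1 * p y)
  (k.+1%:R * (x ^+ k * p x) - (s ^+ 2)^-1 * (x ^+ k.+2 * p x)).
Proof.
have -> : (fun y => y ^+ k.+1 * p y) = (id : R -> R) ^+ k.+1 * p.
  by apply/funext => y; rewrite /= exprfctE.
apply: is_derive_eq; first exact: is_deriveM.
rewrite /= exprfctE /GRing.scale/=.
rewrite [x ^+ k.+2]exprS [x ^+ k.+1]exprS; field.
by rewrite s_neq0.
Qed.

(** Multiplied by |x| >= 1, the left side is still at most x^4 times the density, hence bounded;
    this leaves decay of order 1/|x|. *)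
Let expr_pdf_le k x : (k <= 3)%N -> 1 <= `|x| ->
  `|x ^+ k * p x| <= K * normal_peak s' * `|x|^-1.
Proof.
move=> k3 x1; have x0 : 0 < `|x| by apply: lt_le_trans x1.
rewrite ler_pdivlMr// normrM (ger0_norm (normal_pdf_ge0 _ _ _)) normrX.
rewrite mulrAC -exprSr; apply: (@le_trans _ _ (x ^+ 4 * p x)).
  rewrite ler_wpM2r ?normal_pdf_ge0//.
  have -> : x ^+ 4 = `|x| ^+ 4 by rewrite -normrX ger0_norm// exprn_even_ge0.
  by rewrite ler_weXn2l.
apply: le_trans (expr4_pdf_le x) _.
by rewrite ler_wpM2l// normal_pdf_ub.
Qed.

(** Only |u n| = n matters, so the boundary terms at n and at -n are treated together. *)
Let cvg_expr_pdf k (u : nat -> R) : (k <= 3)%N -> (forall n, `|u n| = n%:R) ->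
  u n ^+ k * p (u n) @[n --> \oo] --> (0 : R).
Proof.
move=> k3 un.
apply: norm_cvg0; rewrite -(cvg_shiftn 1).
apply: (@squeeze_cvgr _ _ _ _ (fun=> 0) (fun n => K * normal_peak s' * n.+1%:R^-1)).
- near=> n; rewrite normr_ge0/= (le_trans (expr_pdf_le k3 _))// un addn1//.
  by rewrite ler1n.
- exact: cvg_cst.
- rewrite -[X in _ --> X](mulr0 (K * normal_peak s')).
  by apply: cvgMr; exact: cvg_harmonic.
Unshelve. all: by end_near. Qed.

(** Integration by parts: the derivative of x^(k+1) p has zero integral. The cases k = 0 and k = 2
    give the second and fourth moments. *)
Let moment k : (k <= 2)%N ->
  \int[mu]_x (x ^+ k.+2 * p x) = k.+1%:R * s ^+ 2 * \int[mu]_x (x ^+ k * p x).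
Proof.
move=> k2.
pose f x := k.+1%:R * (x ^+ k * p x) - (s ^+ 2)^-1 * (x ^+ k.+2 * p x).
have i1 := integrable_expr_normal_pdf (leq_trans k2 (isT : 2 <= 4)%N).
have i2 : mu.-integrable setT (fun x => (x ^+ k.+2 * p x)%:E).
  by apply: integrable_expr_normal_pdf.
have i1' : mu.-integrable setT (EFin \o (fun x => k.+1%:R * (x ^+ k * p x))).
  rewrite (_ : _ \o _ = fun x => (k.+1%:R%:E * (x ^+ k * p x)%:E)%E)//.
  exact: integrableZl.
have i2' : mu.-integrable setT (EFin \o (fun x => (s ^+ 2)^-1 * (x ^+ k.+2 * p x))).
  rewrite (_ : _ \o _ = fun x => ((s ^+ 2)^-1%:E * (x ^+ k.+2 * p x)%:E)%E)//.
  exact: integrableZl.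
have fi : mu.-integrable setT (EFin \o f).
  rewrite (_ : _ \o _ = fun x => ((k.+1%:R * (x ^+ k * p x))%:E
     - ((s ^+ 2)^-1 * (x ^+ k.+2 * p x))%:E)%E)//.
  exact: integrableB.
have cf : continuous f.
  have cp : continuous p by exact: continuous_normal_pdf.
  move=> x; apply: cvgB; apply: cvgM; try exact: cvg_cst;
    by apply: cvgM; [exact: exprn_continuous|exact: cp].
have I0 : (\int[mu]_x (f x)%:E = 0)%E.
  apply: (@integral_derivative_eq0 R (fun y => y ^+ k.+1 * p y)) => //.
  - by apply: cvg_expr_pdf => // n; rewrite ger0_norm.
  - by apply: cvg_expr_pdf => // n; rewrite normrN ger0_norm.
have : \int[mu]_x f x = 0 by rewrite /Rintegral I0.
rewrite /f RintegralB// RintegralZl// RintegralZl//.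
move/eqP; rewrite subr_eq0 => /eqP J0.
by rewrite mulrAC J0 mulrAC mulVf ?mul1r// sqrf_eq0.
Qed.

(** The first moment lies below the reach of the recursion; here x p is, up to a constant factor,
    the derivative of p itself. *)
Let moment1 : \int[mu]_x (x ^+ 1 * p x) = 0.
Proof.
pose f x := - x / s ^+ 2 * p x.
have i1 : mu.-integrable setT (fun x => (x ^+ 1 * p x)%:E).
  exact: integrable_expr_normal_pdf.
have fE x : f x = - (s ^+ 2)^-1 * (x ^+ 1 * p x).
  by rewrite /f expr1; field; rewrite s_neq0.
have cf : continuous f.
  have cp : continuous p by exact: continuous_normal_pdf.
  rewrite (_ : f = fun x => - (s ^+ 2)^-1 * (x ^+ 1 * p x)); last exact/funext.
  by move=> x; apply: cvgM; [exact: cvg_cst|apply: cvgM; [exact: exprn_continuous|exact: cp]].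
have fi : mu.-integrable setT (EFin \o f).
  rewrite (_ : _ \o _ = fun x => ((- (s ^+ 2)^-1)%:E * (x ^+ 1 * p x)%:E)%E).
    exact: integrableZl.
  by apply/funext => x; rewrite /= fE.
have I0 : (\int[mu]_x (f x)%:E = 0)%E.
  apply: (@integral_derivative_eq0 R p) => //.
  - rewrite (_ : (fun n => _) = fun n : nat => n%:R ^+ 0 * p n%:R); last first.
      by apply/funext => n; rewrite expr0 mul1r.
    by apply: cvg_expr_pdf => // n; rewrite ger0_norm.
  - rewrite (_ : (fun n => _) = fun n : nat => (- n%:R) ^+ 0 * p (- n%:R)).
      by apply: cvg_expr_pdf => // n; rewrite normrN ger0_norm.
    by apply/funext => n; rewrite expr0 mul1r.
have : \int[mu]_x f x = 0 by rewrite /Rintegral I0.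
under eq_Rintegral do rewrite fE.
rewrite RintegralZl// => /eqP; rewrite mulf_eq0 oppr_eq0 invr_eq0 sqrf_eq0.
by rewrite (negbTE s_neq0)/= => /eqP.
Qed.

Let moment0 : \int[mu]_x (x ^+ 0 * p x) = 1.
Proof.
rewrite /Rintegral; under eq_integral do rewrite expr0 mul1r.
by rewrite integral_normal_pdf.
Qed.

Let mexpr k : measurable_fun setT (fun x : R => x ^+ k).
Proof. exact: measurable_funX. Qed.

Lemma integrable_expr_normal_prob k : (k <= 4)%N ->
  (normal_prob 0 s).-integrable setT (fun x : R => (x ^+ k)%:E).
Proof.
by move=> k4; apply: integrable_normal_prob => //; exact: integrable_expr_normal_pdf.
Qed.

Let nmoment k : (k <= 4)%N ->
  (\int[normal_prob 0 s]_x (x ^+ k)%:E = (\int[mu]_x (x ^+ k * p x))%:E)%E.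
Proof.
move=> k4; have ik := integrable_expr_normal_pdf k4.
rewrite integral_normal_prob// /Rintegral fineK//; exact: integrable_fin_num.
Qed.

Lemma integral_expr1_normal_prob : (\int[normal_prob 0 s]_x (x ^+ 1)%:E = 0)%E.
Proof. by rewrite nmoment// moment1. Qed.

Lemma integral_expr2_normal_prob :
  (\int[normal_prob 0 s]_x (x ^+ 2)%:E = (s ^+ 2)%:E)%E.
Proof. by rewrite nmoment// moment// moment0 mul1r mulr1. Qed.

Lemma integral_expr4_normal_prob :
  (\int[normal_prob 0 s]_x (x ^+ 4)%:E = (3 * s ^+ 4)%:E)%E.
Proof.
rewrite nmoment// moment// moment// moment0 mulr1 mul1r -mulrA -exprD//.
Qed.

End normal_moments.

(** * Borel sets and Euclidean geometry of row vectors *)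

Section borel_row_vector_theory.
Context {R : realType} {d : nat}.
Implicit Types (B : 'I_d -> set R).

(** The pi-system on which [brownian_motion] prescribes the law of an increment. *)
Definition boxes : set (set 'rV[R]_d) :=
  [set A | exists2 B : 'I_d -> set R, (forall i, measurable (B i)) &
                      A = [set v : 'rV[R]_d | forall i, B i (v 0 i)]].

Lemma boxes_setI : setI_closed boxes.
Proof.
move=> _ _ [B mB ->] [C mC ->]; exists (fun i => B i `&` C i).
  by move=> i; exact: measurableI.
apply/seteqP; split => v /=; first by move=> [Bv Cv] i; split.
by move=> BC; split => i; have [] := BC i.
Qed.

Lemma boxesT : boxes setT.
Proof. by exists (fun=> setT) => //; apply/seteqP; split. Qed.

(** Balls of row vectors are sup-norm balls, so they contain boxes around their centre; rational
    endpoints leave only countably many boxes. *)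
Lemma open_rV_box (U : set 'rV[R]_d) (v : 'rV[R]_d) : open U -> U v ->
  exists q : {ffun 'I_d -> rat * rat}, let A :=
    [set w : 'rV[R]_d | forall i, ratr (q i).1 < w 0 i < ratr (q i).2] in
  A v /\ A `<=` U.
Proof.
move=> oU Uv; have /nbhs_ballP[_/posnumP[e] eU] := open_nbhs_nbhs (conj oU Uv).
have /choice[q qP] (i : 'I_d) : exists p : rat * rat,
    (ratr p.1 < v 0 i < ratr p.2) /\
    (v 0 i - e%:num < ratr p.1) && (ratr p.2 < v 0 i + e%:num).
  have /rat_in_itvoo[p1] : v 0 i - e%:num < v 0 i by rewrite ltrBlDr ltrDl.
  have /rat_in_itvoo[p2] : v 0 i < v 0 i + e%:num by rewrite ltrDl.
  rewrite !in_itv/= => /andP[a b] /andP[a' b'].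
  by exists (p1, p2); rewrite /= a b a' b'.
exists [ffun i => q i] => A; split => [i|w Aw].
  by rewrite ffunE; have [] := qP i.
apply: eU; split => // i j; rewrite ord1.
have := Aw j; rewrite ffunE => /andP[w1 w2]; have [_ /andP[q1 q2]] := qP j.
rewrite /ball/= ltr_distl; apply/andP; split; lra.
Qed.

Lemma open_rV_gen_boxes : @open 'rV[R]_d `<=` <<s boxes >>.
Proof.
move=> U oU.
pose A (q : {ffun 'I_d -> rat * rat}) : set 'rV[R]_d :=
  [set w | forall i, ratr (q i).1 < w 0 i < ratr (q i).2].
(* An index that codes no box, or a box not inside [U], contributes the empty set. *)
pose C n := if unpickle n is Some q then
  if `[< A q `<=` U >] then A q else set0 else set0.
have -> : U = \bigcup_n C n.
  apply/seteqP; split => [v Uv|v [n _]]; last first.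
    by rewrite /C; case: unpickle => // q; case: asboolP => // AU /AU.
  have [q [Aqv AqU]] := open_rV_box oU Uv.
  by exists (pickle q) => //; rewrite /C pickleK asboolT.
apply: sigma_algebra_bigcup => n; rewrite /C.
case: unpickle => [q|]; last exact: sigma_algebra0.
case: asboolP => _; last exact: sigma_algebra0.
apply: sub_gen_smallest.
exists (fun i => [set` `]ratr (q i).1, ratr (q i).2[]) => //.
Qed.

Lemma measurable_coord (i : 'I_d) :
  measurable_fun setT (fun v : 'rV[R]_d => v 0 i).
Proof.
apply: (measurability _ (RGenOpens.measurableE R)).
move=> _ [_ [x [y ->]] <-]; rewrite setTI; apply: sub_gen_smallest.
apply: open_comp => [v _|]; [exact: coord_continuous|exact: interval_open].
Qed.

Lemma boxes_measurable : boxes `<=` measurable.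
Proof.
move=> _ [B mB ->].
have -> : [set v : 'rV[R]_d | forall i, B i (v 0 i)] =
    \bigcap_(i in [set: 'I_d]) ((fun v : 'rV[R]_d => v 0 i) @^-1` B i).
  by apply/seteqP; split => [v Bv i _|v Bv i]; exact: Bv.
apply: fin_bigcap_measurable => [|i _]; first exact: finite_finset.
by rewrite -[X in measurable X]setTI; exact: measurable_coord.
Qed.

Lemma measurable_rVE : @measurable _ 'rV[R]_d = <<s boxes >>.
Proof.
apply/seteqP; split.
  apply: smallest_sub; first exact: smallest_sigma_algebra.
  exact: open_rV_gen_boxes.
apply: smallest_sub; first exact: sigma_algebra_measurable.
exact: boxes_measurable.
Qed.

Lemma measurable_fun_rV {dT} {T : measurableType dT} (f : T -> 'rV[R]_d) :
  (forall i, measurable_fun setT (fun x => f x 0 i)) -> measurable_fun setT f.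
Proof.
move=> mf; apply: (measurability boxes); first exact: measurable_rVE.
move=> _ [_ [B mB ->] <-]; rewrite setTI.
have -> : f @^-1` [set v : 'rV[R]_d | forall i, B i (v 0 i)] =
    \bigcap_(i in [set: 'I_d]) ((fun x => f x 0 i) @^-1` B i).
  by apply/seteqP; split => [v Bv i _|v Bv i]; exact: Bv.
apply: fin_bigcap_measurable => [|i _]; first exact: finite_finset.
by rewrite -[X in measurable X]setTI; exact: mf.
Qed.

(** Boxes are stable under intersection and generate the Borel sets. Increments of Brownian motions
    on different bases are thereby identified in law. *)
Lemma probability_rV_unique (m1 m2 : probability 'rV[R]_d R) :
  (forall B : 'I_d -> set R, (forall i, measurable (B i)) ->
     m1 [set v | forall i, B i (v 0 i)] = m2 [set v | forall i, B i (v 0 i)]) ->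
  forall A, measurable A -> m1 A = m2 A.
Proof.
move=> m12 A mA; apply: (measure_unique boxes (fun=> setT)) => //.
- exact: measurable_rVE.
- exact: boxes_setI.
- by move=> _; exact: boxesT.
- by rewrite bigcup_const.
- by move=> _ [B mB ->]; exact: m12.
- by move=> _; rewrite (le_lt_trans (probability_le1 _ _))// ltry.
Qed.

Lemma measurable_addrV {dT} {T : measurableType dT} (f g : T -> 'rV[R]_d) :
  measurable_fun setT f -> measurable_fun setT g ->
  measurable_fun setT (fun x => f x + g x).
Proof.
move=> mf mg; apply: measurable_fun_rV => i.
under eq_fun do rewrite mxE.
apply: measurable_funD.
  exact: (measurableT_comp (measurable_coord i) mf).
exact: (measurableT_comp (measurable_coord i) mg).
Qed.

Lemma measurable_scalerV {dT} {T : measurableType dT} (c : R) (f : T -> 'rV[R]_d) :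
  measurable_fun setT f -> measurable_fun setT (fun x => c *: f x).
Proof.
move=> mf; apply: measurable_fun_rV => i.
under eq_fun do rewrite mxE.
apply: measurable_funM => //.
exact: (measurableT_comp (measurable_coord i) mf).
Qed.

Lemma measurable_subrV {dT} {T : measurableType dT} (f g : T -> 'rV[R]_d) :
  measurable_fun setT f -> measurable_fun setT g ->
  measurable_fun setT (fun x => f x - g x).
Proof.
move=> mf mg; under eq_fun do rewrite -scaleN1r.
by apply: measurable_addrV => //; exact: measurable_scalerV.
Qed.

Lemma measurable_dotp {dT} {T : measurableType dT} (f g : T -> 'rV[R]_d) :
  measurable_fun setT f -> measurable_fun setT g ->
  measurable_fun setT (fun x => dotp (f x) (g x)).
Proof.
move=> mf mg; rewrite /dotp; apply: measurable_sum => i.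
apply: measurable_funM.
  exact: (measurableT_comp (measurable_coord i) mf).
exact: (measurableT_comp (measurable_coord i) mg).
Qed.

Lemma measurable_enorm : measurable_fun setT (@enorm R d).
Proof.
rewrite (_ : enorm = Num.sqrt \o (fun x => dotp x x))//.
apply: measurableT_comp.
  by apply: continuous_measurable_fun; exact: sqrt_continuous.
by apply: measurable_dotp; exact: measurable_id.
Qed.

End borel_row_vector_theory.

(** * Euclidean inequalities *)

Section euclidean_theory.
Context {R : realType} {d : nat}.
Implicit Types x y z : 'rV[R]_d.

Lemma dotpC x y : dotp x y = dotp y x.
Proof. by apply: eq_bigr => i _; rewrite mulrC. Qed.

Lemma dotpDl x y z : dotp (x + y) z = dotp x z + dotp y z.
Proof. by rewrite /dotp -big_split; apply: eq_bigr => i _; rewrite mxE mulrDl. Qed.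

Lemma dotpZl (c : R) x y : dotp (c *: x) y = c * dotp x y.
Proof. by rewrite /dotp mulr_sumr; apply: eq_bigr => i _; rewrite mxE mulrA. Qed.

Lemma dotpDr x y z : dotp z (x + y) = dotp z x + dotp z y.
Proof. by rewrite dotpC dotpDl !(dotpC z). Qed.

Lemma dotpZr (c : R) x y : dotp x (c *: y) = c * dotp x y.
Proof. by rewrite dotpC dotpZl dotpC. Qed.

Lemma dotp_ge0 x : 0 <= dotp x x.
Proof. by apply: sumr_ge0 => i _; rewrite -expr2 sqr_ge0. Qed.

Lemma enorm_ge0 x : 0 <= enorm x.
Proof. exact: sqrtr_ge0. Qed.

Lemma enorm_sqr x : enorm x ^+ 2 = dotp x x.
Proof. by rewrite sqr_sqrtr// dotp_ge0. Qed.

Lemma enormD_sqr x y : enorm (x + y) ^+ 2 = enorm x ^+ 2 + 2 * dotp x y + enorm y ^+ 2.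
Proof. by rewrite !enorm_sqr dotpDl !dotpDr (dotpC y x); ring. Qed.

Lemma enormZ (c : R) x : enorm (c *: x) = `|c| * enorm x.
Proof.
by rewrite /enorm dotpZl dotpZr mulrA -expr2 sqrtrM ?sqr_ge0// sqrtr_sqr.
Qed.

Lemma enormN x : enorm (- x) = enorm x.
Proof. by rewrite -scaleN1r enormZ normrN1 mul1r. Qed.

(** Cauchy-Schwarz, from the nonnegative square norm of |y|^2 x - <x,y> y; the case |y| = 0 is
    separate because the argument divides by |y|^2. *)
Lemma dotp_le_enorm x y : dotp x y <= enorm x * enorm y.
Proof.
have [y0|y0] := eqVneq (enorm y) 0.
  rewrite y0 mulr0 /dotp big1// => i _.
  have /eqP : dotp y y = 0 by rewrite -enorm_sqr y0 expr0n.
  rewrite psumr_eq0 => [/allP/(_ i (mem_index_enum i))|j _]; last first.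
    by rewrite -expr2 sqr_ge0.
  by rewrite -expr2 sqrf_eq0 => /eqP ->; rewrite mulr0.
have ny : 0 < enorm y by rewrite lt_neqAle eq_sym y0 enorm_ge0.
have := dotp_ge0 (enorm y ^+ 2 *: x - dotp x y *: y).
rewrite -scaleNr dotpDl !dotpDr !dotpZl !dotpZr -!enorm_sqr (dotpC y x) => h.
have {}h : 0 <= enorm y ^+ 2 * (enorm y ^+ 2 * enorm x ^+ 2 - dotp x y ^+ 2).
  by apply: le_trans h _; rewrite le_eqVlt; apply/orP; left; apply/eqP; ring.
rewrite pmulr_rge0 ?exprn_gt0// subr_ge0 -exprMn in h.
have [dxy|dxy] := leP 0 (dotp x y); last first.
  by apply: le_trans (ltW dxy) _; rewrite mulr_ge0 ?enorm_ge0.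
by rewrite -(@ler_pXn2r _ 2) ?nnegrE ?mulr_ge0 ?enorm_ge0// [enorm x * _]mulrC.
Qed.

Lemma ler_enormD x y : enorm (x + y) <= enorm x + enorm y.
Proof.
rewrite -(@ler_pXn2r _ 2) ?nnegrE ?addr_ge0 ?enorm_ge0// enormD_sqr sqrrD.
by have := dotp_le_enorm x y; rewrite -mulr_natl; lra.
Qed.

Lemma ler_enormB x y : enorm x - enorm y <= enorm (x + y).
Proof.
rewrite lerBlDr; have := ler_enormD (x + y) (- y).
by rewrite addrK enormN.
Qed.

(** With S = |x|^2, expand the sum over i of (d x_i^2 - S)^2 >= 0. This reduces the fourth moment of
    the norm to those of the coordinates. *)
Lemma enorm_expr4_le x : enorm x ^+ 4 <= d%:R * \sum_(i < d) x 0 i ^+ 4.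
Proof.
have -> : enorm x ^+ 4 = (dotp x x) ^+ 2 by rewrite -enorm_sqr -exprM.
have -> : dotp x x = \sum_(i < d) x 0 i ^+ 2 by apply: eq_bigr => i _; rewrite expr2.
set S := \sum_(i < d) x 0 i ^+ 2.
have [d0|d0] := posnP d.
  by rewrite /S; move: x S; rewrite d0 => x _; rewrite big_ord0 expr0n mul0r.
have : 0 <= \sum_(i < d) (d%:R * x 0 i ^+ 2 - S) ^+ 2.
  by apply: sumr_ge0 => i _; exact: sqr_ge0.
rewrite (eq_bigr (fun i => d%:R ^+ 2 * x 0 i ^+ 4
    - 2 * d%:R * S * x 0 i ^+ 2 + S ^+ 2)); last first.
  by move=> i _; ring.
rewrite big_split sumrB/= -!mulr_sumr -/S sumr_const card_ord -mulr_natl.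
set T := \sum_(i < d) _ ^+ 4 => h.
have {}h : 0 <= d%:R * (d%:R * T - S ^+ 2).
  by apply: le_trans h _; rewrite le_eqVlt; apply/orP; left; apply/eqP; ring.
by rewrite pmulr_rge0 ?ltr0n// subr_ge0 in h; rewrite mulr1.
Qed.

End euclidean_theory.

(** * Propagation of a coupling along the scheme *)

Section law.
Local Open Scope ereal_scope.
Context d d' (T : measurableType d) (T' : measurableType d') (R : realType).
Variables (P : probability T R) (f : T -> T') (mf : measurable_fun setT f).

Definition law : probability T' R :=
  distribution P (mfun_Sub (mem_set mf) : {mfun T >-> T'}).

Lemma lawE A : law A = P (f @^-1` A).
Proof. by []. Qed.

Lemma ge0_integral_law (h : T' -> \bar R) : measurable_fun setT h ->
  (forall y, 0 <= h y) -> \int[law]_y h y = \int[P]_x h (f x).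
Proof. by move=> mh h0; rewrite ge0_integral_distribution. Qed.

Lemma integral_law (h : T' -> \bar R) : measurable_fun setT h ->
  P.-integrable setT (h \o f) -> \int[law]_y h y = \int[P]_x h (f x).
Proof. by move=> mh ih; rewrite integral_distribution. Qed.

End law.

(** The centred Gaussian law of covariance delta Id, in the form of the last clause of
    [brownian_motion]; by [probability_rV_unique] it determines [gam]. *)
Definition gaussian_law {R : realType} {d : nat} (delta : R)
    (gam : probability 'rV[R]_d R) := forall B : 'I_d -> set R,
  (forall i, measurable (B i)) ->
  gam [set v | forall i, B i (v 0 i)] =
  (\prod_(i < d) normal_prob 0%R (Num.sqrt delta) (B i))%E.

(** * Moments of a Gaussian vector *)

Section gaussian_moments.
Context {R : realType} {d : nat} (delta : R) (gam : probability 'rV[R]_d R).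
Hypotheses (delta_gt0 : 0 < delta) (gam_gauss : gaussian_law delta gam).
Notation s := (Num.sqrt delta).

Let s_gt0 : 0 < s. Proof. by rewrite sqrtr_gt0. Qed.
Let s2 : s ^+ 2 = delta. Proof. by rewrite sqr_sqrtr// ltW. Qed.
Let s4 : s ^+ 4 = delta ^+ 2. Proof. by rewrite -[in RHS]s2 -exprM. Qed.

(* normal_prob lives on measurableTypeR R, whose display is not that of R *)
Let coordR (i : 'I_d) : 'rV[R]_d -> measurableTypeR R := fun v => v 0 i.

Let measurable_coordR i : measurable_fun setT (coordR i).
Proof. exact: measurable_coord. Qed.

Let gaussian_marginal i (A : set (measurableTypeR R)) : measurable A ->
  law gam (measurable_coordR i) A = normal_prob 0 s A.
Proof.
move=> mA; pose B j : set R := if j == i then A else setT.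
transitivity (gam [set v : 'rV[R]_d | forall j, B j (v 0 j)]).
  congr (gam _); apply/seteqP; split => [v Av j|v /(_ i)]; rewrite /B; last by rewrite eqxx.
  by case: eqP => [->|].
rewrite gam_gauss; last by move=> j; rewrite /B; case: ifP.
rewrite (bigD1 i)//= {1}/B eqxx big1 ?mule1// => j /negPf ji.
by rewrite /B ji; exact: probability_setT.
Qed.

Let integral_marginal i (f : R -> \bar R) :
  (\int[law gam (measurable_coordR i)]_x f x = \int[normal_prob 0 s]_x f x)%E.
Proof.
apply: (eq_measure_integral (normal_prob 0 s)) => A mA _.
exact: gaussian_marginal.
Qed.

Lemma integrable_gaussian_coord i k : (k <= 4)%N ->
  gam.-integrable setT (fun v : 'rV[R]_d => (v 0 i ^+ k)%:E).
Proof.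
move=> k4; have /integrableP[mk ik] := integrable_expr_normal_prob s_gt0 k4.
have mi := measurable_coordR i.
apply/integrableP; split; first exact: (measurableT_comp mk mi).
apply: le_lt_trans ik; rewrite -(integral_marginal i).
rewrite ge0_integral_law//.
by apply: measurableT_comp.
Qed.

Lemma integral_gaussian_coord i k : (k <= 4)%N ->
  (\int[gam]_v ((v : 'rV[R]_d) 0 i ^+ k)%:E =
   \int[normal_prob 0 s]_x (x ^+ k)%:E)%E.
Proof.
move=> k4; have /integrableP[mk ik] := integrable_expr_normal_prob s_gt0 k4.
rewrite -(integral_marginal i).
rewrite integral_law//.
exact: integrable_gaussian_coord.
Qed.

(** A polynomial majorant is integrated term by term. The linear part [a] has mean zero and so
    leaves no trace in the bound; squares give [delta], fourth powers [3 * delta ^+ 2]. *)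
Lemma gaussian_integral_le (G : 'rV[R]_d -> R) (A b c : R) (a : 'rV[R]_d) :
  measurable_fun setT G -> (forall h, 0 <= G h) ->
  (forall h, G h <= A + \sum_(i < d) (a 0 i * h 0 i ^+ 1 + b * h 0 i ^+ 2 + c * h 0 i ^+ 4)) ->
  (\int[gam]_h (G h)%:E <= (A + d%:R * (b * delta + c * (3 * delta ^+ 2)))%:E)%E.
Proof.
move=> mG G0 Gle.
pose m i k (h : 'rV[R]_d) := (h 0 i ^+ k)%:E.
pose Hsum h := (\sum_(i < d) ((a 0 i)%:E * m i 1%N h + b%:E * m i 2%N h
  + c%:E * m i 4%N h))%E.
pose H h := (A%:E + Hsum h)%E.
have im i k : (k <= 4)%N -> gam.-integrable setT (m i k) by exact: integrable_gaussian_coord.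
have i1 i := integrableZl measurableT (a 0 i) (im i 1%N isT).
have i2 i := integrableZl measurableT b (im i 2%N isT).
have i4 i := integrableZl measurableT c (im i 4%N isT).
have i12 i := integrableD measurableT (i1 i) (i2 i).
have i124 i := integrableD measurableT (i12 i) (i4 i).
have iA : gam.-integrable setT (fun=> A%:E) by exact: finite_measure_integrable_cst.
have iS : gam.-integrable setT Hsum.
  by apply: integrable_sum => // i _; exact: i124.
have -> : (A + d%:R * (b * delta + c * (3 * delta ^+ 2)))%:E = (\int[gam]_h H h)%E.
  rewrite integralD// integral_cst//= [gam _]probability_setT mule1.
  rewrite integral_sum//.
  rewrite EFinD; congr (_ + _)%E.
  rewrite (eq_bigr (fun=> (b * delta + c * (3 * delta ^+ 2))%:E)); last first.
    move=> i _; rewrite (integralD measurableT (i12 i) (i4 i)).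
    rewrite (integralD measurableT (i1 i) (i2 i)).
    rewrite !(integralZl measurableT (im _ _ _))//.
    rewrite !integral_gaussian_coord// integral_expr1_normal_prob//.
    rewrite integral_expr2_normal_prob// integral_expr4_normal_prob// s2 s4.
    by rewrite mule0 add0e.
  by rewrite sumEFin sumr_const card_ord mulr_natl.
apply: ge0_le_integral => //.
- by move=> h _; rewrite lee_fin.
- exact/measurable_EFinP.
- by apply: measurable_int (integrableD measurableT iA iS).
- move=> h _; rewrite /H /Hsum (eq_bigr (fun i => (a 0 i * h 0 i ^+ 1
      + b * h 0 i ^+ 2 + c * h 0 i ^+ 4)%:E)).
    by rewrite sumEFin -EFinD lee_fin.
  by move=> i _; rewrite /m -!EFinM -!EFinD.
Qed.

End gaussian_moments.

(** * The scheme as a Markov chain *)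

Section markov_step.
Context {R : realType} {d : nat} {dO : measure_display} {Omega : measurableType dO}.
Variables (P : probability Omega R) (F : R -> set (set Omega)).
Variables (W : R -> Omega -> 'rV[R]_d) (X : nat -> Omega -> 'rV[R]_d).
Variables (pid bd : 'rV[R]_d -> 'rV[R]_d) (sigma delta : R).
Hypotheses (delta_gt0 : 0 < delta) (mpid : measurable_fun setT pid)
  (mbd : measurable_fun setT bd).
Hypotheses (filtF : complete_filtration P F) (BW : brownian_motion P F W).
Hypotheses (X0F : measurable_wrt (F 0) (X 0%N))
  (XE : modified_euler pid bd sigma delta W X).

Definition euler_drift (x : 'rV[R]_d) := pid x + delta *: bd (pid x).

Lemma measurable_euler_drift : measurable_fun setT euler_drift.
Proof.
by apply: measurable_addrV => //; apply: measurable_scalerV; apply: measurableT_comp.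
Qed.

Let t_ge0 n : 0 <= n%:R * delta.
Proof. by rewrite mulr_ge0// ltW. Qed.

Let F_sigma t : 0 <= t -> sigma_algebra setT (F t).
Proof. by have [+ _ _ _] := filtF; exact. Qed.

Let F_measurable t : 0 <= t -> F t `<=` measurable.
Proof. by have [_ + _ _] := filtF; exact. Qed.

Let F_mono s t : 0 <= s -> s <= t -> F s `<=` F t.
Proof. by have [_ _ + _] := filtF; exact. Qed.

(** Viewing [F t] as the sigma-algebra of a type makes the usual closure properties of measurable
    functions available for adaptedness. *)
Let measurable_wrtP t (f : Omega -> 'rV[R]_d) : 0 <= t ->
  measurable_wrt (F t) f <->
  measurable_fun setT (f : g_sigma_algebraType (F t) -> 'rV[R]_d).
Proof.
move=> t0; have E := measurable_g_measurableTypeE (F_sigma t0).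
split => [mf _ A mA|mf A mA].
  by rewrite setTI; apply: sub_gen_smallest; exact: mf.
by rewrite -E -[X in _ X]setTI; exact: mf.
Qed.

Lemma brownian_increment_measurable_wrt s t : 0 <= s -> s <= t ->
  measurable_wrt (F t) (fun w => W t w - W s w).
Proof.
have [_ _ WF _ _] := BW.
move=> s0 st; have t0 := le_trans s0 st.
have mt : measurable_wrt (F t) (W t) by exact: WF.
have ms : measurable_wrt (F t) (W s).
  by move=> A mA; apply: (F_mono s0 st); exact: WF.
apply/measurable_wrtP => //.
move: mt ms => /(measurable_wrtP _ t0) mt /(measurable_wrtP _ t0) ms.
exact: measurable_subrV.
Qed.

Lemma euler_adapted n : measurable_wrt (F (n%:R * delta)) (X n).
Proof.
elim: n => [|n IH]; first by rewrite mul0r.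
have le_t : n%:R * delta <= n.+1%:R * delta by rewrite ler_wpM2r ?ler_nat// ltW.
have XF : measurable_wrt (F (n.+1%:R * delta)) (X n).
  by move=> A mA; apply: (F_mono (t_ge0 n) le_t); exact: IH.
have := brownian_increment_measurable_wrt (t_ge0 n) le_t.
move: XF => /(measurable_wrtP _ (t_ge0 _)) XF /(measurable_wrtP _ (t_ge0 _)) dW.
apply/measurable_wrtP => //.
rewrite (_ : X n.+1 = fun w => euler_drift (X n w) +
  sigma *: (W (n.+1%:R * delta) w - W (n%:R * delta) w)); last first.
  by apply/funext => w; rewrite XE.
apply: measurable_addrV; last exact: measurable_scalerV.
exact: measurableT_comp measurable_euler_drift XF.
Qed.

Lemma wrt_measurable_fun t (f : Omega -> 'rV[R]_d) : 0 <= t ->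
  measurable_wrt (F t) f -> measurable_fun setT f.
Proof. by move=> t0 mf _ A mA; rewrite setTI; apply: (F_measurable t0); exact: mf. Qed.

Lemma measurable_euler n : measurable_fun setT (X n).
Proof. exact: wrt_measurable_fun (t_ge0 n) (euler_adapted n). Qed.

Notation dW n := (fun w => W (n.+1%:R * delta) w - W (n%:R * delta) w).

Lemma measurable_increment n : measurable_fun setT (dW n).
Proof.
apply: (wrt_measurable_fun (t_ge0 n.+1)).
apply: brownian_increment_measurable_wrt => //.
by rewrite ler_wpM2r ?ler_nat// ltW.
Qed.

Lemma gaussian_increment n : gaussian_law delta (law P (measurable_increment n)).
Proof.
have [_ _ _ _ Wlaw] := BW; move=> B mB; rewrite lawE.
have tlt : n%:R * delta < n.+1%:R * delta by rewrite ltr_pM2r// ltr_nat.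
have := Wlaw _ _ (t_ge0 n) tlt B mB.
have -> : n.+1%:R * delta - n%:R * delta = delta by rewrite -natr1; ring.
by [].
Qed.

(** The increment is independent of [F (n%:R * delta)], to which [X n] is adapted, so the next law
    depends only on the law of [X n] and a Gaussian law. Both [q] and [gam] may live outside the
    basis: [q] will be a coordinate of a coupling, [gam] possibly an increment law of another
    basis. *)
Lemma euler_step_law {dT} {T : measurableType dT} (g : probability T R)
    (gam : probability 'rV[R]_d R) (q : T -> 'rV[R]_d) n :
  measurable_fun setT q -> gaussian_law delta gam ->
  (forall B, measurable B -> g (q @^-1` B) = P (X n @^-1` B)) ->
  forall A, measurable A ->
  P (X n.+1 @^-1` A) =
  (g \x gam)%E [set z | A (euler_drift (q z.1) + sigma *: z.2)].
Proof.
move=> mq ggam gq A mA.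
pose Phi (z : 'rV[R]_d * 'rV[R]_d) := euler_drift z.1 + sigma *: z.2.
have mPhi : measurable_fun setT Phi.
  apply: measurable_addrV; last exact: measurable_scalerV.
  exact: measurableT_comp measurable_euler_drift _.
have mS : measurable (Phi @^-1` A) by rewrite -[X in measurable X]setTI; exact: mPhi.
have mXW : measurable_fun setT (fun w => (X n w, dW n w)).
  by apply: measurable_fun_pair; [exact: measurable_euler|exact: measurable_increment].
have mqz : measurable_fun setT (fun z : T * 'rV[R]_d => (q z.1, z.2)).
  by apply: measurable_fun_pair => //; exact: measurableT_comp mq _.
have -> : P (X n.+1 @^-1` A) = law P mXW (Phi @^-1` A).
  by rewrite lawE; congr (P _); apply/funext => w; rewrite /preimage/= XE.
transitivity (law (g \x gam)%E mqz (Phi @^-1` A)); last by [].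
(* Both sides are the product of the law of [q] and [gam], because they agree with it on rectangles:
   by construction for the right side, by independence for the left. *)
rewrite -(@product_measure_unique _ _ _ _ _ (law g mq) gam (law P mXW))//.
  apply: (@product_measure_unique _ _ _ _ _ (law g mq) gam
    (law (g \x gam)%E mqz)) => // B C mB mC.
  transitivity ((g \x gam)%E ((q @^-1` B) `*` C)); first by [].
  rewrite product_measure1E//; rewrite -[X in measurable X]setTI; exact: mq.
move=> B C mB mC.
have [_ _ _ Windep _] := BW.
have tlt : n%:R * delta < n.+1%:R * delta by rewrite ltr_pM2r// ltr_nat.
transitivity (P (X n @^-1` B) * gam C)%E; last by congr (_ * _)%E; exact/esym/gq.
have -> : gam C = law P (measurable_increment n) C.
  apply: probability_rV_unique mC => B' mB'.
  by rewrite ggam//; apply/esym/gaussian_increment.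
by have := Windep _ _ (t_ge0 n) tlt (X n @^-1` B) C (euler_adapted n mB) mC.
Qed.

End markov_step.

(** * The synchronous coupling and its cost *)

Section synchronous_coupling.
Context {R : realType} {d : nat}.
Variables (pid bd : 'rV[R]_d -> 'rV[R]_d) (sigma delta : R).
Hypotheses (delta_gt0 : 0 < delta) (mpid : measurable_fun setT pid)
  (mbd : measurable_fun setT bd).
Variables (kappa : R) (rho : 'rV[R]_d * 'rV[R]_d -> R).
Hypotheses (kappa_ge0 : 0 <= kappa) (mrho : measurable_fun setT rho)
  (rho_ge0 : forall z, 0 <= rho z).
Notation drift := (euler_drift pid bd delta).
Hypothesis rho_step : forall z gam, gaussian_law delta gam ->
  (\int[gam]_h (rho (drift z.1 + sigma *: h, drift z.2 + sigma *: h))%:E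
    <= (kappa * rho z)%:E)%E.

Let Psi (u : ('rV[R]_d * 'rV[R]_d) * 'rV[R]_d) : 'rV[R]_d * 'rV[R]_d :=
  (drift u.1.1 + sigma *: u.2, drift u.1.2 + sigma *: u.2).

Let measurable_drift := measurable_euler_drift delta mpid mbd.

Let measurable_Psi : measurable_fun setT Psi.
Proof.
apply: measurable_fun_pair; apply: measurable_addrV.
- apply: measurableT_comp measurable_drift _.
  exact: measurableT_comp measurable_fst measurable_fst.
- exact: measurable_scalerV.
- apply: measurableT_comp measurable_drift _.
  exact: measurableT_comp measurable_snd measurable_fst.
- exact: measurable_scalerV.
Qed.

Let mrhoE : measurable_fun setT (fun z => (rho z)%:E).
Proof. exact/measurable_EFinP. Qed.

(** The coupling is pushed forward by adding the same Gaussian vector to both drifted coordinates.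
    Each marginal then follows its own scheme, and the mean cost shrinks by [kappa] per step. *)
Lemma euler_coupling n (mu nu mun nun : probability 'rV[R]_d R)
    (g : probability ('rV[R]_d * 'rV[R]_d)%type R) :
  euler_law pid bd sigma delta n mu mun ->
  euler_law pid bd sigma delta n nu nun -> coupling mu nu g ->
  exists2 g' : probability ('rV[R]_d * 'rV[R]_d)%type R, coupling mun nun g' &
    (\int[g']_z (rho z)%:E <= (kappa ^+ n)%:E * \int[g]_z (rho z)%:E)%E.
Proof.
move=> [d1 [Om1 [P1 [F1 [W1 [X1 [[f1 b1] a1 e1 i1 l1]]]]]]].
move=> [d2 [Om2 [P2 [F2 [W2 [X2 [[f2 b2] a2 e2 i2 l2]]]]]]] [g1 g2].
(* The marginals are expressed through [X1 n] and [X2 n], so that the induction does not fix the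
   final laws. *)
have [gn [gn1 gn2 gle]] : exists g' : probability ('rV[R]_d * 'rV[R]_d)%type R,
    [/\ forall A, measurable A -> g' (A `*` setT) = P1 (X1 n @^-1` A),
        forall A, measurable A -> g' (setT `*` A) = P2 (X2 n @^-1` A) &
    (\int[g']_z (rho z)%:E <= (kappa ^+ n)%:E * \int[g]_z (rho z)%:E)%E].
  elim: n {l1 l2} => [|n [h [h1 h2 hle]]].
    exists g; split=> [A mA|A mA|]; last by rewrite expr0 mul1e.
      by rewrite g1// i1.
    by rewrite g2// i2.
  (* The increment law of the first basis drives both copies; being Gaussian, it is also the
     increment law of the second. *)
  pose gam := law P1 (measurable_increment delta_gt0 f1 b1 n).
  have gamG : gaussian_law delta gam by exact: gaussian_increment.
  exists (law (h \x gam)%E measurable_Psi); split => [A mA|A mA|].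
  - transitivity ((h \x gam)%E [set z | A (drift z.1.1 + sigma *: z.2)]).
      by rewrite lawE; congr ((h \x gam)%E _); apply/seteqP; split => u //= [].
    apply/esym/(euler_step_law delta_gt0 mpid mbd f1 b1 a1 e1) => // B mB.
    by rewrite -h1//; congr (h _); apply/seteqP; split => u //= [].
  - transitivity ((h \x gam)%E [set z | A (drift z.1.2 + sigma *: z.2)]).
      by rewrite lawE; congr ((h \x gam)%E _); apply/seteqP; split => u //= [].
    apply/esym/(euler_step_law delta_gt0 mpid mbd f2 b2 a2 e2) => // B mB.
    by rewrite -h2//; congr (h _); apply/seteqP; split => u //= [].
  - rewrite ge0_integral_law//.
    (* Integrate over the noise first, with the pair of starting points fixed, so that [rho_step]
       applies. *)
    rewrite fubini_tonelli1//; first last.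
    + by move=> u; rewrite lee_fin.
    + exact: measurableT_comp mrhoE measurable_Psi.
    apply: (@le_trans _ _ (\int[h]_z (kappa%:E * (rho z)%:E))%E).
      apply: ge0_le_integral => //.
      * by move=> z _; apply: integral_ge0 => u _; rewrite lee_fin.
      * apply: measurable_fun_fubini_tonelli_F => //.
          exact: measurableT_comp mrhoE measurable_Psi.
        by move=> u; rewrite lee_fin.
      * exact: measurable_funeM.
      * by move=> z _; rewrite -EFinM; exact: rho_step.
    rewrite ge0_integralZl_EFin//; last by move=> z _; rewrite lee_fin.
    by rewrite exprS EFinM -muleA lee_wpmul2l// lee_fin.
exists gn => //; split => A mA; first by rewrite gn1// l1.
by rewrite gn2// l2.
Qed.

Variable c : R.
Hypothesis rho_lower : forall z, enorm (z.1 - z.2) ^+ 2 <= rho z.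
Hypothesis rho_upper : forall z, rho z <= c * enorm (z.1 - z.2) ^+ 2.

(** Since [rho] lies between the squared distance and [c] times it, the cost contraction passes to
    the squared distance with factor [kappa ^+ n * c]. Every coupling of the initial laws yields one
    of the final laws, and the infimum is taken afterwards. *)
Lemma W2_contraction n (C : R) (mu nu mun nun : probability 'rV[R]_d R) :
  euler_law pid bd sigma delta n mu mun ->
  euler_law pid bd sigma delta n nu nun ->
  0 <= c -> 0 < C -> kappa ^+ n * c <= C ^+ 2 ->
  (W2 mun nun <= C%:E * W2 mu nu)%E.
Proof.
move=> lmu lnu c0 C0 kC.
have m2 : measurable_fun setT
    (fun z : 'rV[R]_d * 'rV[R]_d => (enorm (z.1 - z.2) ^+ 2)%:E).
  apply/measurable_EFinP/measurable_funX/measurableT_comp.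
    exact: measurable_enorm.
  exact: measurable_subrV.
have e0 (z : 'rV[R]_d * 'rV[R]_d) : (0 <= (enorm (z.1 - z.2) ^+ 2)%:E)%E.
  by rewrite lee_fin sqr_ge0.
rewrite -lee_pdivrMl//; apply: le_ereal_inf_tmp => _ [g gc <-].
rewrite lee_pdivrMl//.
have [g' cg gle] := euler_coupling lmu lnu gc.
apply: (@le_trans _ _ ((\int[g']_z (enorm (z.1 - z.2) ^+ 2)%:E) `^ 2^-1)%E).
  by apply: ereal_inf_lbound; exists g'.
have -> : C%:E = ((C ^+ 2)%:E `^ 2^-1)%E.
  by rewrite poweR_EFin powR12_sqrt ?sqr_ge0// sqrtr_sqr gtr0_norm.
rewrite -poweRM ?lee_fin ?sqr_ge0 ?integral_ge0//.
apply: gt0_ler_poweR; rewrite ?invr_ge0//.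
- by rewrite in_itv/= leey andbT integral_ge0.
- by rewrite in_itv/= leey andbT mule_ge0 ?lee_fin ?sqr_ge0 ?integral_ge0.
apply: (@le_trans _ _ (\int[g']_z (rho z)%:E)%E).
  by apply: ge0_le_integral => // z _; rewrite lee_fin.
apply: le_trans gle _.
apply: (@le_trans _ _ ((kappa ^+ n)%:E * \int[g]_z (c%:E * (enorm (z.1 - z.2) ^+ 2)%:E))%E).
  rewrite lee_wpmul2l ?lee_fin ?exprn_ge0//.
  apply: ge0_le_integral => //.
  - by move=> z _; rewrite lee_fin.
  - exact: measurable_funeM.
  - by move=> z _; rewrite -EFinM lee_fin.
rewrite ge0_integralZl_EFin// muleA -EFinM lee_wpmul2r ?integral_ge0//.
Qed.

End synchronous_coupling.

(** * One-step estimates *)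

Section capped_norm.
Context {R : realType} {d : nat}.
Implicit Types x z : 'rV[R]_d.
Variables (rho L eta : R).
Hypotheses (rho_gt0 : 0 < rho) (L_gt0 : 0 < L) (etaL : eta * L = 2 * rho).

Definition capnorm x := capsq rho L eta (enorm x).
(** The plateau value of [capnorm], which is also its maximum. *)
Definition captop := rho ^+ 2 + rho * L.

Lemma measurable_capnorm : measurable_fun setT capnorm.
Proof.
have mv : measurable_fun setT (fun x => Num.min (Num.max (enorm x - rho) 0) L).
  apply: measurable_minr => //; apply: measurable_maxr => //.
  by apply: measurable_funB => //; exact: measurable_enorm.
apply: measurable_funB; last first.
  by apply: measurable_funM => //; exact: measurable_funX.
apply: measurable_funD; last exact: measurable_funM.
by apply: measurable_funX; apply: measurable_minr => //; exact: measurable_enorm.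
Qed.

Lemma capnorm_le x : capnorm x <= captop.
Proof. by apply: capsq_le => //; exact: enorm_ge0. Qed.

Lemma capnorm_ge0 x : 0 <= capnorm x.
Proof. by apply: capsq_ge0 => //; exact: enorm_ge0. Qed.

(** The scalar slope is placed along x/|x|. Cauchy-Schwarz bounds <x,z>/|x| by |x+z| - |x|, and the
    reverse triangle inequality handles the quadratic term. *)
Lemma capnorm_semiconvex x : exists a : 'rV[R]_d, forall z,
  capnorm x + dotp a z - eta / 2 * enorm z ^+ 2 <= capnorm (x + z).
Proof.
have eta_gt0 : 0 < eta.
  by rewrite -(pmulr_lgt0 eta L_gt0) etaL mulr_gt0.
have [a [a0 ax aP]] := capsq_semiconvex rho_gt0 L_gt0 etaL (enorm_ge0 x).
exists ((a / enorm x) *: x) => z.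
apply: le_trans (aP _ (enorm_ge0 (x + z))); rewrite /capnorm.
have : a / enorm x * dotp x z <= a * (enorm (x + z) - enorm x).
  (* At the origin [0^-1 = 0] makes the slope vector vanish, and [0 <= a] suffices. *)
  have [x0|x0] := eqVneq (enorm x) 0.
    by rewrite x0 in ax *; rewrite invr0 mulr0 mul0r subr0 mulr_ge0 ?enorm_ge0.
  rewrite -mulrA ler_wpM2l// ler_pdivrMl ?lt_neqAle 1?eq_sym ?x0 ?enorm_ge0//.
  have := dotp_le_enorm x (x + z); rewrite dotpDr -enorm_sqr; lra.
have : (enorm (x + z) - enorm x) ^+ 2 <= enorm z ^+ 2.
  have := dotp_le_enorm (x + z) x; rewrite dotpDl (dotpC z x) -enorm_sqr.
  by have := enormD_sqr x z; lra.
rewrite dotpZl => /(ler_wpM2l (ltW eta_gt0)); lra.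
Qed.

(** Within radius [rho] there is no loss. To pass [rho = 1 + r], the step must have |z| > 7/8, and
    then |z|^4 dominates the deficit |x+z|^2 - rho^2. *)
Lemma capnorm_ge_sqr (r : R) x z : 0 <= r -> rho = 1 + r ->
    enorm x <= r + 8^-1 ->
  enorm x ^+ 2 + 2 * dotp x z + enorm z ^+ 2 - (1 + r ^+ 2) / 2 * enorm z ^+ 4
    <= capnorm (x + z).
Proof.
move=> r0 rhoE xr; rewrite -enormD_sqr /capnorm.
have q0 := enorm_ge0 z; have := ler_enormD x z.
set t := enorm (x + z); set q := enorm z in q0 * => tq.
have [trho|rhot] := leP t rho.
  rewrite capsq_small// gerBl mulr_ge0 ?exprn_ge0//.
  by rewrite divr_ge0// addr_ge0// sqr_ge0.
have := capsq_homo rho_gt0 L_gt0 etaL (ltW rho_gt0) (ltW rhot).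
rewrite (capsq_small rho_gt0 L_gt0 etaL (lexx rho)); apply: le_trans.
pose u := t - rho; have u0 : 0 <= u by rewrite subr_ge0 ltW.
have uq : u <= q - 7 / 8 by rewrite /u; lra.
have Q0 := sqr_ge0 (q ^+ 2 - 21 / 16).
have q4 : q ^+ 4 = q ^+ 2 * q ^+ 2 by rewrite -exprD.
have u1 : u <= q ^+ 4 / 6.
  have := sqr_ge0 (q - 8 / 7); rewrite q4; nra.
have u2 : u ^+ 2 <= q ^+ 4 / 12.
  have h : u <= q ^+ 2 * (2 / 7) by have := sqr_ge0 (q - 7 / 4); nra.
  have : u ^+ 2 <= (q ^+ 2 * (2 / 7)) ^+ 2 by rewrite lerXn2r// nnegrE ?mulr_ge0 ?sqr_ge0.
  rewrite q4; nra.
have h1 : rho * u <= rho * (q ^+ 4 / 6) by rewrite ler_wpM2l// ltW.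
(* The deficit is [2 * rho * u + u ^+ 2], at most q^4 (rho/3 + 1/12) by [u1] and [u2]. *)
have h2 : 0 <= q ^+ 4 * ((1 + r ^+ 2) / 2 - rho / 3 - 1 / 12).
  apply: mulr_ge0; first exact: exprn_ge0.
  by rewrite rhoE; have := sqr_ge0 (r - 1 / 3); lra.
have -> : t = rho + u by rewrite /u; ring.
rewrite sqrrD -mulr_natl; lra.
Qed.

Variables (delta sigma : R) (gam : probability 'rV[R]_d R).
Hypotheses (delta_gt0 : 0 < delta) (ggam : gaussian_law delta gam).

Lemma measurable_capnorm_shift x :
  measurable_fun setT (fun h : 'rV[R]_d => captop - capnorm (x + sigma *: h)).
Proof.
apply: measurable_funB => //; apply: measurableT_comp measurable_capnorm _.
by apply: measurable_addrV => //; exact: measurable_scalerV.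
Qed.

Let sum_expr2 (h : 'rV[R]_d) : \sum_(i < d) h 0 i ^+ 2 = dotp h h.
Proof. by apply: eq_bigr => i _; rewrite expr2. Qed.

(** In the mean the supporting plane contributes nothing; only the curvature bound [eta / 2] is
    paid, once per coordinate. *)
Lemma integral_capnorm_le x :
  (\int[gam]_h (captop - capnorm (x + sigma *: h))%:E <=
   (captop - capnorm x + d%:R * (eta / 2 * sigma ^+ 2 * delta))%:E)%E.
Proof.
have [a aP] := capnorm_semiconvex x.
have -> : d%:R * (eta / 2 * sigma ^+ 2 * delta) = 
    d%:R * (eta / 2 * sigma ^+ 2 * delta + 0 * (3 * delta ^+ 2)) by ring.
apply: (gaussian_integral_le delta_gt0 ggam (a := - sigma *: a)).
- exact: measurable_capnorm_shift.
- by move=> h; rewrite subr_ge0 capnorm_le.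
move=> h; have := aP (sigma *: h); rewrite enormZ exprMn real_normK ?num_real//.
rewrite enorm_sqr dotpZr !big_split/= -!mulr_sumr sum_expr2.
have -> : \sum_(i < d) (- sigma *: a) 0 i * h 0 i ^+ 1 = - sigma * dotp a h.
  by rewrite -dotpZl.
lra.
Qed.

(** Near the ball the noise raises the square by its full variance; the correction comes from
    [enorm_expr4_le], which bounds the mean of |h|^4 by 3 d^2 delta^2. *)
Lemma integral_capnorm_inner_le (r : R) x : 0 <= r -> rho = 1 + r ->
    enorm x <= r + 8^-1 ->
  (\int[gam]_h (captop - capnorm (x + sigma *: h))%:E <=
   (captop - enorm x ^+ 2 - d%:R * sigma ^+ 2 * delta
    + 3 / 2 * (1 + r ^+ 2) * (d%:R * sigma ^+ 2 * delta) ^+ 2)%:E)%E.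
Proof.
move=> r0 rhoE xr.
have -> : captop - enorm x ^+ 2 - d%:R * sigma ^+ 2 * delta
    + 3 / 2 * (1 + r ^+ 2) * (d%:R * sigma ^+ 2 * delta) ^+ 2 =
    captop - enorm x ^+ 2 + d%:R * (- sigma ^+ 2 * delta +
      (1 + r ^+ 2) / 2 * sigma ^+ 4 * d%:R * (3 * delta ^+ 2)).
  by field.
apply: (gaussian_integral_le delta_gt0 ggam (a := (- (2 * sigma)) *: x)).
- exact: measurable_capnorm_shift.
- by move=> h; rewrite subr_ge0 capnorm_le.
move=> h; have := capnorm_ge_sqr (sigma *: h) r0 rhoE xr.
rewrite enormZ !exprMn real_normK ?num_real//.
have -> : `|sigma| ^+ 4 = sigma ^+ 4 by rewrite -normrX ger0_norm// exprn_even_ge0.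
rewrite [enorm h ^+ 2]enorm_sqr dotpZr !big_split/= -!mulr_sumr sum_expr2.
have -> : \sum_(i < d) (- (2 * sigma) *: x) 0 i * h 0 i ^+ 1 = - (2 * sigma) * dotp x h.
  by rewrite -dotpZl.
move=> le1.
have c0 : 0 <= (1 + r ^+ 2) / 2 * sigma ^+ 4.
  by rewrite mulr_ge0 ?exprn_even_ge0// divr_ge0// addr_ge0// sqr_ge0.
have := ler_wpM2l c0 (enorm_expr4_le h); lra.
Qed.

End capped_norm.

Lemma integral_weight_le {R : realType} {d : nat} (gam : probability 'rV[R]_d R)
    (D k e1 e2 : R) (U1 U2 : 'rV[R]_d -> R) :
  0 <= D -> 0 <= k -> measurable_fun setT U1 -> measurable_fun setT U2 ->
  (forall h, 0 <= U1 h) -> (forall h, 0 <= U2 h) ->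
  (\int[gam]_h (U1 h)%:E <= e1%:E)%E -> (\int[gam]_h (U2 h)%:E <= e2%:E)%E ->
  (\int[gam]_h (D * (1 + k * U1 h + k * U2 h))%:E <= (D * (1 + k * e1 + k * e2))%:E)%E.
Proof.
move=> D0 k0 mU1 mU2 U10 U20 i1 i2.
have m1 : measurable_fun setT (fun h => (U1 h)%:E) by exact/measurable_EFinP.
have m2 : measurable_fun setT (fun h => (U2 h)%:E) by exact/measurable_EFinP.
under eq_integral do rewrite EFinM.
rewrite ge0_integralZl_EFin//; last 2 first.
- by move=> h _; rewrite lee_fin !addr_ge0 ?mulr_ge0.
- apply/measurable_EFinP; apply: measurable_funD; last exact: measurable_funM.
  by apply: measurable_funD => //; exact: measurable_funM.
rewrite EFinM lee_wpmul2l ?lee_fin//.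
under eq_integral do rewrite !EFinD !EFinM.
rewrite ge0_integralD//; last 4 first.
- by move=> h _; rewrite adde_ge0 ?mule_ge0 ?lee_fin.
- by apply: emeasurable_funD => //; exact: measurable_funeM.
- by move=> h _; rewrite mule_ge0 ?lee_fin.
- exact: measurable_funeM.
rewrite ge0_integralD//; last 2 first.
- by move=> h _; rewrite mule_ge0 ?lee_fin.
- exact: measurable_funeM.
rewrite !ge0_integralZl_EFin//; last 2 first.
- by move=> h _; rewrite lee_fin.
- by move=> h _; rewrite lee_fin.
rewrite integral_cst//= probability_setT mule1 !EFinD.
by rewrite !leeD// EFinM lee_wpmul2l ?lee_fin.
Qed.

(** * Step-size restrictions and arithmetic of the weight *)

Lemma powR_le_root {R : realType} (x a e : R) : 0 <= x -> 0 <= a -> 0 < e ->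
  x <= a `^ (1 / e) -> x `^ e <= a.
Proof.
move=> x0 a0 e0 /(ge0_ler_powR (ltW e0)); rewrite !nnegrE powR_ge0 => /(_ x0 isT).
by rewrite -powRrM mul1r mulVf ?gt_eqF// powRr1.
Qed.

(** Makes the term delta^2 |b(x) - b(y)|^2 absorbable by half of the dissipation. *)
Lemma step_size_lip {R : realType} (delta K KR theta : R) :
  0 < delta -> 0 < K -> 0 < KR -> theta < 1 / 2 ->
  delta <= (K / KR ^+ 2) `^ (1 / (1 - 2 * theta)) ->
  (KR * delta `^ (- theta)) ^+ 2 * delta <= K.
Proof.
move=> d0 K0 KR0 th le_d.
have : delta `^ (1 - 2 * theta) <= K / KR ^+ 2.
  apply: powR_le_root le_d; first exact: ltW; last by lra.
  by rewrite divr_ge0 ?exprn_ge0 ?ltW.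
have -> : delta `^ (1 - 2 * theta) = (delta `^ (- theta)) ^+ 2 * delta.
  rewrite powRD; last by rewrite (gt_eqF d0) implybT.
  rewrite powRr1 ?ltW// mulrC; congr (_ * _).
  by rewrite -powR_mulrn ?powR_ge0// -powRrM; congr (_ `^ _); ring.
by rewrite ler_pdivlMr ?exprn_gt0// exprMn => h; lra.
Qed.

(** Ensures that the linearly growing part of the drift moves a point by at most half its norm. *)
Lemma step_size_growth {R : realType} (delta p theta : R) :
  0 < delta -> 0 < p -> theta < 1 ->
  delta <= (2 * p) `^ (1 / (theta - 1)) -> p * delta `^ (- theta) * delta <= 1 / 2.
Proof.
move=> d0 p0 th le_d.
have : delta `^ (1 - theta) <= (2 * p)^-1.
  have p2 : 0 <= 2 * p by rewrite mulr_ge0// ltW.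
  apply: powR_le_root; [exact: ltW|by rewrite invr_ge0|by rewrite subr_gt0|].
  rewrite -(powR_inv1 p2) -powRrM; apply: le_trans le_d _.
  rewrite le_eqVlt; apply/orP; left; apply/eqP; congr (_ `^ _).
  by field; apply/andP; split; lra.
have -> : delta `^ (1 - theta) = delta `^ (- theta) * delta.
  rewrite powRD; last by rewrite (gt_eqF d0) implybT.
  by rewrite powRr1 ?ltW// mulrC.
have e : p * (2 * p)^-1 = 1 / 2 by field; rewrite gt_eqF.
by move=> /(ler_wpM2l (ltW p0)); rewrite e; lra.
Qed.

Lemma growth_step {R : realType} (delta psi g e b : R) (i : bool) :
  0 < delta <= 1 -> 0 <= psi -> 0 <= g -> 0 <= e -> g * delta <= 1 / 2 ->
  b <= psi + g * e * i%:R -> delta * b <= psi + 1 / 2 * e.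
Proof.
move=> /andP[d0 d1] psi0 g0 e0 gd.
have ge0 : 0 <= g * e by exact: mulr_ge0.
have ge_i : g * e * i%:R <= g * e by case: i; rewrite ?mulr1 ?mulr0.
move=> /le_trans/(_ (lerD (lexx psi) ge_i))/(ler_wpM2l (ltW d0)).
by have := ler_wpM2r e0 gd; have := ler_wpM2r psi0 d1; lra.
Qed.

(** As [w <= c], the identity for [c] gives (l + 3C) w <= 6C: the drop of the weight pays for both
    the expansion and the rate [l]. A negative bracket is treated apart, since [D] is only bounded
    above. *)
Lemma weight_step_inner {R : realType} (C delta c l q2 D w : R) :
  0 <= delta -> 0 <= C -> 0 <= q2 -> 0 <= D -> l * delta <= 1 ->
  0 <= l -> (l + 3 * C) * c = 6 * C -> 0 <= w -> w <= c ->
  D <= (1 + 3 * C * delta) * q2 ->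
  D * (w - 6 * C * delta) <= (1 - l * delta) * (q2 * w).
Proof.
move=> d0 C0 q0 D0 ld l0 lc w0 wc DC.
have [neg|pos] := leP (w - 6 * C * delta) 0.
  apply: (@le_trans _ _ 0); first exact: mulr_ge0_le0.
  by apply: mulr_ge0; [rewrite subr_ge0|exact: mulr_ge0].
apply: le_trans (ler_wpM2r (ltW pos) DC) _.
have l3 : 0 <= l + 3 * C by lra.
have := ler_wpM2l l3 wc; rewrite lc => wl.
have := ler_wpM2l (mulr_ge0 q0 d0) wl.
have : 0 <= q2 * (C * delta) ^+ 2 by rewrite mulr_ge0 ?sqr_ge0.
lra.
Qed.

(** As [1 <= w], the increase 3a/4 of the weight uses up at most three quarters of the contraction
    [a]. *)
Lemma weight_step_outer {R : realType} (a q2 D w : R) :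
  0 <= a -> 0 <= q2 -> 1 <= w -> D <= (1 - a) * q2 ->
  D * (w + 3 / 4 * a) <= (1 - a / 4) * (q2 * w).
Proof.
move=> a0 q0 w1 DC.
have pos : 0 <= w + 3 / 4 * a by lra.
apply: le_trans (ler_wpM2r pos DC) _.
have := ler_wpM2l (mulr_ge0 q0 a0) w1; have := mulr_ge0 q0 (sqr_ge0 a); lra.
Qed.

Section one_step.
Context {R : realType} {d : nat}.
Implicit Types x y p v px py bx b_y : 'rV[R]_d.

(** The distance grows by at most 1 + C delta, and (1 + C delta)^2 <= 1 + 3 C delta when C delta <=
    1. *)
Lemma drift_contract_inner px py bx b_y (C q delta : R) :
  0 <= delta -> 0 <= C -> C * delta <= 1 -> 0 <= q ->
  enorm (px - py) <= q -> enorm (bx - b_y) <= C * q ->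
  enorm ((px + delta *: bx) - (py + delta *: b_y)) ^+ 2 <= (1 + 3 * C * delta) * q ^+ 2.
Proof.
move=> d0 C0 Cd q0 pq bq.
have -> : (px + delta *: bx) - (py + delta *: b_y) = (px - py) + delta *: (bx - b_y).
  by rewrite scalerBr opprD addrACA.
have h : enorm ((px - py) + delta *: (bx - b_y)) <= (1 + C * delta) * q.
  apply: le_trans (ler_enormD _ _) _; rewrite enormZ ger0_norm//.
  by have := ler_wpM2l d0 bq; lra.
have Cd0 : 0 <= C * delta by exact: mulr_ge0.
apply: (@le_trans _ _ (((1 + C * delta) * q) ^+ 2)).
  by rewrite lerXn2r// nnegrE ?enorm_ge0// mulr_ge0// addr_ge0.
by rewrite exprMn ler_wpM2r ?sqr_ge0//; nra.
Qed.

(** The cross term gains 2 K delta and the quadratic term returns at most K delta. The condition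
    [2 * K * delta <= 1] keeps the coefficient of |px - py|^2 nonnegative, so that this norm can be
    replaced by [q]. *)
Lemma drift_contract_outer px py bx b_y (K B q delta : R) :
  0 <= delta -> 2 * K * delta <= 1 -> B ^+ 2 * delta <= K ->
  0 <= q -> 0 <= B -> enorm (px - py) <= q -> enorm (bx - b_y) <= B * q ->
  dotp (px - py) (bx - b_y) <= - K * enorm (px - py) ^+ 2 ->
  enorm ((px + delta *: bx) - (py + delta *: b_y)) ^+ 2 <= (1 - K * delta) * q ^+ 2.
Proof.
move=> d0 Kd BK q0 B0 pq bq diss.
have -> : (px + delta *: bx) - (py + delta *: b_y) = (px - py) + delta *: (bx - b_y).
  by rewrite scalerBr opprD addrACA.
rewrite enormD_sqr dotpZr enormZ ger0_norm// exprMn.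
have e0 := enorm_ge0 (px - py); set e := enorm (px - py) in e0 pq diss *.
have b2 : enorm (bx - b_y) ^+ 2 <= (B * q) ^+ 2.
  by rewrite lerXn2r// nnegrE ?enorm_ge0// mulr_ge0.
have e2 : e ^+ 2 <= q ^+ 2 by rewrite lerXn2r// nnegrE.
have h1 := ler_wpM2l d0 diss.
have h2 := ler_wpM2l (sqr_ge0 delta) b2.
have Kd' : 0 <= 1 - 2 * K * delta by lra.
have h3 := ler_wpM2l Kd' e2.
have h4 := ler_wpM2l (mulr_ge0 d0 (sqr_ge0 q)) BK.
lra.
Qed.

(** The first bound keeps the drifted point where [capnorm_ge_sqr] applies; the second limits what
    the drift takes from the square. *)
Lemma drift_norm_inner x p v (B r delta : R) : 0 <= delta ->
  enorm p = enorm x -> enorm x <= r -> enorm v <= B ->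
  enorm (p + delta *: v) <= r + delta * B /\
  enorm x ^+ 2 - 2 * r * (delta * B) <= enorm (p + delta *: v) ^+ 2.
Proof.
move=> d0 px xr vB; split.
  apply: le_trans (ler_enormD _ _) _.
  by rewrite px lerD// enormZ ger0_norm// ler_wpM2l.
rewrite enormD_sqr px dotpZr.
have := dotp_le_enorm (- p) v; rewrite enormN px -scaleN1r dotpZl => e1.
have e2 : enorm x * enorm v <= r * B by rewrite ler_pM ?enorm_ge0.
have := ler_wpM2l d0 (le_trans e1 e2).
by have := sqr_ge0 (enorm (delta *: v)); lra.
Qed.

Variables (rho L eta : R).
Hypotheses (rho_gt0 : 0 < rho) (L_gt0 : 0 < L) (etaL : eta * L = 2 * rho).

Lemma capnorm_shift_ge x p v (B : R) : enorm p = enorm x -> enorm v <= B ->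
  capnorm rho L eta x - 2 * rho * B <= capnorm rho L eta (p + v).
Proof.
move=> px vB; have pv : enorm x - B <= enorm (p + v).
  by rewrite -px; apply: le_trans (ler_enormB p v); rewrite lerD2l lerN2.
have r0 : 0 <= 2 * rho by rewrite mulr_ge0// ltW.
have B0 : 0 <= 2 * rho * B := mulr_ge0 r0 (le_trans (enorm_ge0 v) vB).
rewrite /capnorm; have [le_x|lt_x] := leP (enorm x) (enorm (p + v)).
  by have := capsq_homo rho_gt0 L_gt0 etaL (enorm_ge0 x) le_x; lra.
have := capsq_lip rho_gt0 L_gt0 etaL (enorm_ge0 (p + v)) (ltW lt_x).
have := ler_wpM2l r0 pv; lra.
Qed.

(** A far point keeps at least half its norm minus [B], hence stays on the plateau. *)
Lemma capnorm_shift_top p v (B : R) : 2 * (rho + L + B) <= enorm p ->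
  enorm v <= B + 1 / 2 * enorm p -> capnorm rho L eta (p + v) = captop rho L.
Proof.
move=> pB vB; rewrite /capnorm capsq_large//.
by have := ler_enormB p v; lra.
Qed.

End one_step.

(** * Contraction in the Wasserstein distance *)

Theorem theorem2p4 (R : realType) (d : nat) (hd : (1 <= d)%N) (sigma : R)
    (b : 'rV[R]_d -> 'rV[R]_d) (bd pid : R -> 'rV[R]_d -> 'rV[R]_d)
    (mb : measurable_fun setT b)
    (mbd : forall delta, 0 < delta <= 1 -> measurable_fun setT (bd delta))
    (mpid : forall delta, 0 < delta <= 1 -> measurable_fun setT (pid delta))
    (bd_cvg : forall x,
      enorm (bd delta x - b x) @[delta --> 0^'+] --> (0 : R))
    (pid_cvg : forall x,
      enorm (pid delta x - x) @[delta --> 0^'+] --> (0 : R))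
    (pid0 : forall delta, 0 < delta <= 1 -> pid delta 0 = 0)
    (pid_contr : forall delta, 0 < delta <= 1 -> forall x y,
      enorm (pid delta x - pid delta y) <= enorm (x - y))
    (r C_R K_R K_R' theta delta_R : R)
    (r_gt0 : 0 < r) (C_R_gt0 : 0 < C_R) (K_R_gt0 : 0 < K_R)
    (K_R'_gt0 : 0 < K_R')
    (theta_bnd : 0 <= theta < 1 / 2) (delta_R_bnd : 0 < delta_R <= 1)
    (b_lip_in : forall delta, 0 < delta <= delta_R -> forall x y,
      enorm x <= r -> enorm y <= r ->
      enorm (bd delta (pid delta x) - bd delta (pid delta y))
        <= C_R * enorm (x - y))
    (b_lip_out : forall delta, 0 < delta <= delta_R -> forall x y,
      r < enorm x \/ r < enorm y ->
      enorm (bd delta (pid delta x) - bd delta (pid delta y))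
        <= K_R * delta `^ (- theta) * enorm (x - y))
    (b_diss : forall delta, 0 < delta <= delta_R -> forall x y,
      r < enorm x \/ r < enorm y ->
      dotp (pid delta x - pid delta y)
           (bd delta (pid delta x) - bd delta (pid delta y))
        <= - K_R' * enorm (pid delta x - pid delta y) ^+ 2)
    (delta_star : R -> R)
    (delta_star_bnd : forall s, 0 < s -> 0 < delta_star s <= 1)
    (pid_inf : forall s, 0 < s -> forall delta, 0 < delta <= delta_star s ->
      s <= inf [set enorm (pid delta x) | x in [set x | s <= enorm x]])
    (pid_norm : forall s, 0 < s -> forall delta, 0 < delta <= delta_star s ->
      forall x, enorm x <= s -> enorm (pid delta x) = enorm x)
    (psi1 psi2 : R -> R)
    (psi1_gt0 : forall s, 0 <= s -> 0 < psi1 s)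
    (psi2_gt0 : forall s, 0 <= s -> 0 < psi2 s)
    (psi1_incr : forall s t, 0 <= s -> s <= t -> psi1 s <= psi1 t)
    (psi2_incr : forall s t, 0 <= s -> s <= t -> psi2 s <= psi2 t)
    (b_growth : forall delta, 0 < delta <= 1 -> forall x s, 0 <= s ->
      enorm (bd delta (pid delta x)) <=
      psi1 s + psi2 s * delta `^ (- theta) * enorm (pid delta x)
               * (s < enorm (pid delta x))%R%:R) :
  let R0 := 2 * ((1 + r) * (1 + 96 * C_R / K_R') + psi1 1) in
  8 * (1 + r) / (d%:R * K_R')
    * Num.max (3 * C_R * (K_R' + 96 * C_R) * (1 + r))
        (Num.max (psi1 r * K_R') (12 * C_R * psi1 R0)) < sigma ^+ 2 ->
  let lambda1 :=
    6 * C_R * sigma ^+ 2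
      * (sigma ^+ 2
         + 24 * C_R * (K_R' + 96 * C_R) * (1 + r) ^+ 2 / (d%:R * K_R'))^-1
    - 3 * C_R in
  let lambda2 := K_R' / 4 in
  let C0 :=
    (1 + 24 * C_R * (K_R' + 96 * C_R) * (1 + r) ^+ 2
         / (d%:R * K_R' * sigma ^+ 2)) `^ (1 / 2) in
  let delta1 :=
    Num.min delta_R
   (Num.min (2 * K_R')^-1
   (Num.min ((K_R' / K_R ^+ 2) `^ (1 / (1 - 2 * theta)))
   (Num.min (1 / C_R)
   (Num.min (1 / lambda1)
   (Num.min (1 / lambda2)
   (Num.min (delta_star R0)
   (Num.min ((2 * psi2 1) `^ (1 / (theta - 1)))
            (4 * (2 + d%:R) * (1 + r ^+ 2) * sigma ^+ 2)^-1))))))) in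
  forall delta, 0 < delta <= delta1 ->
  forall (n : nat) (mu nu : probability 'rV[R]_d R),
  finite_second_moment mu -> finite_second_moment nu ->
  forall mun nun : probability 'rV[R]_d R,
  euler_law (pid delta) (bd delta) sigma delta n mu mun ->
  euler_law (pid delta) (bd delta) sigma delta n nu nun ->
  (W2 mun nun <=
   (C0 * expR (- (1 / 2) * Num.min lambda1 lambda2 * n%:R * delta))%:E
     * W2 mu nu)%E.

Proof.
move=> R0 sig_gt lambda1 lambda2 C0 delta1 delta hdelta n mu nu _ _ mun nun lmu lnu.
have [delta_gt0 delta_le] := andP hdelta.
have [dR0 dR1] := andP delta_R_bnd; have [th0 th1] := andP theta_bnd.
move: delta_le; rewrite /delta1 !le_min => /andP[le_R /andP[le_K /andP[le_KR
  /andP[le_C /andP[le_l1 /andP[le_l2 /andP[le_star /andP[le_psi le_sig]]]]]]]].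
have hd1 : 0 < delta <= 1 by rewrite delta_gt0 (le_trans le_R).
have hdR : 0 < delta <= delta_R by rewrite delta_gt0.
have d0 : 0 < d%:R :> R by rewrite ltr0n.
have psi1_1 := psi1_gt0 1 ler01.
(* The margin 1 separates the ball from the bend; [eta] is chosen so that curvature costs a quarter
   of the dissipation, and [etaL] then forces [L]. *)
pose rho := 1 + r.
pose L := 96 * C_R * rho / K_R'.
pose eta := K_R' / (48 * C_R).
have rho_gt0 : 0 < rho by rewrite /rho addr_gt0.
have L_gt0 : 0 < L by rewrite /L divr_gt0// !mulr_gt0.
have Kn0 : K_R' != 0 by rewrite gt_eqF.
have Cn0 : C_R != 0 by rewrite gt_eqF.
have dn0 : d%:R != 0 :> R by rewrite gt_eqF.
have etaL : eta * L = 2 * rho.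
  by rewrite /eta /L; field; rewrite Kn0 Cn0.
(* This is the threshold of [capnorm_shift_top] with [B := psi1 1]. *)
have R0E : R0 = 2 * (rho + L + psi1 1).
  by rewrite /R0 /L /rho; field; rewrite Kn0.
have R0_gt0 : 0 < R0 by rewrite R0E mulr_gt0// !addr_gt0.
have rR0 : r <= R0.
  by rewrite R0E /rho; clear -psi1_1 L_gt0 r_gt0; lra.
have hstar : 0 < delta <= delta_star R0 by rewrite delta_gt0.
pose S := d%:R * sigma ^+ 2.
pose M := captop rho L.
(* The three entries of the maximum serve distinct ends: [H1] gives [c < 2], [H2] controls the drift
   inside the ball, [H3] the drift up to [R0]. *)
have sigP X : X <= Num.max (3 * C_R * (K_R' + 96 * C_R) * (1 + r))
    (Num.max (psi1 r * K_R') (12 * C_R * psi1 R0)) -> 8 * rho * X < S * K_R'.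
  move=> Xle; have a0 : 0 < d%:R * K_R' by rewrite mulr_gt0.
  have b0 : 0 <= 8 * rho / (d%:R * K_R') by rewrite divr_ge0// ?ltW// mulr_gt0.
  have := le_lt_trans (ler_wpM2l b0 Xle) sig_gt.
  by rewrite mulrAC ltr_pdivrMr// /S [sigma ^+ 2 * _]mulrCA mulrA.
have H1 : 8 * rho * (3 * C_R * (K_R' + 96 * C_R) * rho) < S * K_R'.
  by apply: sigP; rewrite le_max lexx.
have H2 : 8 * rho * psi1 r < S.
  have : 8 * rho * (psi1 r * K_R') < S * K_R'.
    by apply: sigP; rewrite le_max [X in _ || X]le_max lexx orbT.
  by rewrite mulrA ltr_pM2r.
have H3 : 8 * rho * (12 * C_R * psi1 R0) < S * K_R'.
  by apply: sigP; rewrite le_max [X in _ || X]le_max lexx !orbT.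
have S_gt0 : 0 < S.
  apply: lt_trans H2; rewrite mulr_gt0 ?psi1_gt0 ?ltW// mulr_gt0//.
have Sn0 : S != 0 by rewrite gt_eqF.
have sn0 : sigma != 0 by move: Sn0; rewrite mulf_eq0 sqrf_eq0 negb_or => /andP[].
have ME : M = rho ^+ 2 * (K_R' + 96 * C_R) / K_R'.
  by rewrite /M /captop /L; field; rewrite Kn0.
have M_gt0 : 0 < M by rewrite ME divr_gt0// mulr_gt0 ?exprn_gt0// addr_gt0// mulr_gt0.
(* A mean gain of S delta / 4 at both points then lowers the weight by 6 C_R delta, twice the
   expansion rate. *)
pose k := 12 * C_R / S.
have k_gt0 : 0 < k by rewrite /k divr_gt0// mulr_gt0.
have kS : k * S = 12 * C_R by rewrite /k divfK.
pose c := 1 + 2 * k * M.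
have c_gt1 : 1 < c by rewrite /c ltrDl mulr_gt0// mulr_gt0.
have c_gt0 : 0 < c by apply: lt_trans c_gt1.
have cn0 : c != 0 by rewrite gt_eqF.
have c_lt2 : c < 2.
  rewrite /c -ltrBrDl (_ : 2 - 1 = 1); last by ring.
  have -> : 2 * k * M = 8 * rho * (3 * C_R * (K_R' + 96 * C_R) * rho) / (S * K_R').
    by rewrite /k ME; field; rewrite Kn0 Sn0.
  by rewrite ltr_pdivrMr ?mul1r// mulr_gt0.
have cE : c = 1 + 24 * C_R * (K_R' + 96 * C_R) * (1 + r) ^+ 2 / (d%:R * K_R' * sigma ^+ 2).
  by rewrite /c /k ME /S /rho; field; rewrite Kn0 sn0 dn0.
have C0sq : C0 ^+ 2 = c.
  by rewrite /C0 -cE mul1r powR12_sqrt ?sqr_sqrtr// ltW.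
have l1E : lambda1 = 6 * C_R / c - 3 * C_R.
  rewrite /lambda1; congr (_ - _).
  have -> : sigma ^+ 2 + 24 * C_R * (K_R' + 96 * C_R) * (1 + r) ^+ 2 / (d%:R * K_R')
      = sigma ^+ 2 * c.
    by rewrite cE; field; rewrite Kn0 sn0 dn0.
  by field; rewrite cn0 sn0.
have l1c : (lambda1 + 3 * C_R) * c = 6 * C_R by rewrite l1E; field; rewrite cn0.
have l1_gt0 : 0 < lambda1.
  rewrite -(pmulr_lgt0 _ c_gt0).
  have -> : lambda1 * c = 3 * C_R * (2 - c) by clear -l1c; lra.
  by rewrite mulr_gt0 ?subr_gt0// mulr_gt0.
have l2_gt0 : 0 < lambda2 by rewrite /lambda2 divr_gt0.
pose lam := Num.min lambda1 lambda2.
have lam_l1 : lam <= lambda1 by rewrite ge_min lexx.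
have lam_l2 : lam <= lambda2 by rewrite ge_min lexx orbT.
have dC : C_R * delta <= 1 by move: le_C; rewrite ler_pdivlMr// mulrC.
have dl2 : lambda2 * delta <= 1 by move: le_l2; rewrite ler_pdivlMr// mulrC.
have dK : 2 * K_R' * delta <= 1.
  by move: le_K; rewrite -[X in _ <= X]mul1r ler_pdivlMr ?mulr_gt0// mulrC.
have dS : S * delta * (1 + r ^+ 2) <= 1 / 4.
  have r2 : 0 < 1 + r ^+ 2 by rewrite addr_gt0// exprn_gt0.
  have s2 : 0 < sigma ^+ 2 by rewrite exprn_even_gt0.
  have d2 : 0 < 2 + d%:R :> R by rewrite addr_gt0.
  move: le_sig; rewrite -[X in _ <= X]mul1r ler_pdivlMr; last first.
    by rewrite mulr_gt0// mulr_gt0// mulr_gt0.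
  have := mulr_gt0 (mulr_gt0 delta_gt0 r2) s2; rewrite /S; clear; lra.
pose kappa := 1 - lam * delta.
have kappa_ge0 : 0 <= kappa.
  by rewrite subr_ge0; apply: le_trans dl2; rewrite ler_wpM2r// ltW.
pose U x := M - capnorm (d := d) rho L eta x.
have U_ge0 x : 0 <= U x by rewrite subr_ge0; exact: capnorm_le.
have U_le x : U x <= M by rewrite gerBl; exact: capnorm_ge0.
have mU : measurable_fun setT U.
  by apply: measurable_funB => //; exact: measurable_capnorm.
pose w (z : 'rV[R]_d * 'rV[R]_d) := 1 + k * U z.1 + k * U z.2.
have w_ge1 z : 1 <= w z by rewrite /w -addrA lerDl addr_ge0// mulr_ge0// ltW.
have w_lec z : w z <= c.
  have := ler_wpM2l (ltW k_gt0) (U_le z.1); have := ler_wpM2l (ltW k_gt0) (U_le z.2).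
  by rewrite /w /c; clear; lra.
pose T := euler_drift (pid delta) (bd delta) delta.
have UT gam x : gaussian_law delta gam ->
    (\int[gam]_h (U (T x + sigma *: h))%:E <= (U x + S * K_R' * delta / (32 * C_R))%:E)%E.
  move=> ggam.
  have := integral_capnorm_le rho_gt0 L_gt0 etaL sigma delta_gt0 ggam (T x).
  move=> /le_trans; apply; rewrite lee_fin -/M.
  have -> : d%:R * (eta / 2 * sigma ^+ 2 * delta) = S * K_R' * delta / (96 * C_R).
    by rewrite /eta /S; field; rewrite Cn0.
  have h3 : 2 * rho * (delta * psi1 R0) <= S * K_R' * delta / (48 * C_R).
    rewrite ler_pdivlMr ?mulr_gt0//.
    by have := ler_wpM2r (ltW delta_gt0) (ltW H3); clear; lra.
  have -> : S * K_R' * delta / (32 * C_R) =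
      S * K_R' * delta / (96 * C_R) + S * K_R' * delta / (48 * C_R).
    by field; rewrite Cn0.
  suff : capnorm rho L eta x - 2 * rho * (delta * psi1 R0) <= capnorm rho L eta (T x).
    by rewrite /U; clear -h3; lra.
  have psiR0 := psi1_gt0 R0 (ltW R0_gt0).
  (* Up to [R0] the growth bound at level [R0] has no linear part and the Lipschitz bound applies;
     beyond [R0], the bound at level 1 leaves the drifted point on the plateau. *)
  rewrite /T /euler_drift; have [xR|Rx] := leP (enorm x) R0.
    have px := pid_norm _ R0_gt0 _ hstar _ xR.
    apply: capnorm_shift_ge => //; rewrite enormZ gtr0_norm// ler_wpM2l ?(ltW delta_gt0)//.
    have := b_growth _ hd1 x R0 (ltW R0_gt0).
    by rewrite px ltNge xR/= mulr0 addr0.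
  have pR : R0 <= enorm (pid delta x).
    apply: le_trans (pid_inf _ R0_gt0 _ hstar) _.
    apply: ge_inf; last by exists x => //=; exact: ltW.
    by exists 0 => _ [y _ <-]; exact: enorm_ge0.
  rewrite (capnorm_shift_top rho_gt0 L_gt0 etaL (B := psi1 1)) -?R0E//.
    apply: le_trans (capnorm_le rho_gt0 L_gt0 etaL x).
    by rewrite gerBl mulr_ge0// mulr_ge0// ltW.
  rewrite enormZ gtr0_norm//.
  apply: growth_step (b_growth _ hd1 x 1 ler01) => //; rewrite ?(ltW psi1_1)//.
  - by rewrite mulr_ge0 ?powR_ge0// ltW// psi2_gt0.
  - exact: enorm_ge0.
  - apply: step_size_growth => //; first exact: psi2_gt0.
    by clear -th1; lra.
have UTin gam x : gaussian_law delta gam -> enorm x <= r ->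
    (\int[gam]_h (U (T x + sigma *: h))%:E <= (U x - S * delta / 4)%:E)%E.
  move=> ggam xr.
  have px := pid_norm _ R0_gt0 _ hstar _ (le_trans xr rR0).
  have bx : enorm (bd delta (pid delta x)) <= psi1 r.
    have := b_growth _ hd1 x r (ltW r_gt0).
    by rewrite px ltNge xr/= mulr0 addr0.
  have psir := psi1_gt0 r (ltW r_gt0).
  have Sd : 0 < S * delta by rewrite mulr_gt0.
  have r2 : 0 < r ^+ 2 by rewrite exprn_gt0.
  have Sd4 : S * delta <= 1 / 4.
    by have := mulr_gt0 Sd r2; clear -dS; lra.
  have dpsi : 8 * rho * (delta * psi1 r) <= S * delta.
    by have := ler_wpM2r (ltW delta_gt0) (ltW H2); clear; lra.
  have dp0 : 0 < delta * psi1 r by rewrite mulr_gt0.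
  have rdp0 : 0 < r * (delta * psi1 r) by rewrite mulr_gt0.
  have [Tx TE] := drift_norm_inner (ltW delta_gt0) px xr bx.
  (* The displacement is at most S delta / (8 rho), and S delta <= 1/4. *)
  have {}Tx : enorm (T x) <= r + 8^-1.
    by apply: le_trans Tx _; clear -dpsi rdp0 Sd4; rewrite /rho in dpsi; lra.
  have := integral_capnorm_inner_le rho_gt0 L_gt0 etaL sigma delta_gt0 ggam
    (ltW r_gt0) erefl Tx.
  move=> /le_trans; apply; rewrite lee_fin -/M -/S /U.
  have -> : capnorm rho L eta x = enorm x ^+ 2.
    by rewrite /capnorm capsq_small// /rho; clear -xr; lra.
  (* Of the gain S delta, the fourth-moment term takes at most 3/8 and the drift at most 1/4, which
     leaves more than the required quarter. *)
  have := ler_wpM2l (ltW Sd) dS.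
  rewrite -/(euler_drift (pid delta) (bd delta) delta x) -/T in TE.
  by clear -dpsi TE rdp0 dp0; rewrite /rho in dpsi; lra.
pose W z := enorm (z.1 - z.2) ^+ 2 * w z.
have mW : measurable_fun setT W.
  apply: measurable_funM.
    apply/measurable_funX/measurableT_comp; first exact: measurable_enorm.
    exact: measurable_subrV.
  apply: measurable_funD; last first.
    apply: measurable_funM => //; exact: measurableT_comp mU measurable_snd.
  apply: measurable_funD => //.
  by apply: measurable_funM => //; exact: measurableT_comp mU measurable_fst.
have W_ge0 z : 0 <= W z.
  by rewrite mulr_ge0 ?sqr_ge0// (le_trans _ (w_ge1 z)).
have W_step z gam : gaussian_law delta gam ->
    (\int[gam]_h (W (T z.1 + sigma *: h, T z.2 + sigma *: h))%:E
      <= (kappa * W z)%:E)%E.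
  move=> ggam; case: z => x y /=.
  pose D := enorm (T x - T y) ^+ 2.
  have D0 : 0 <= D by exact: sqr_ge0.
  have q0 := enorm_ge0 (x - y); pose q2 := enorm (x - y) ^+ 2.
  have q20 : 0 <= q2 by exact: sqr_ge0.
  have mUT u : measurable_fun setT (fun h : 'rV[R]_d => U (T u + sigma *: h)).
    exact: measurable_capnorm_shift.
  (* The common noise cancels in the difference, so [D] is deterministic and only the weight is
     averaged. *)
  have step e : (\int[gam]_h (U (T x + sigma *: h))%:E <= (U x + e)%:E)%E ->
      (\int[gam]_h (U (T y + sigma *: h))%:E <= (U y + e)%:E)%E ->
      (\int[gam]_h (W (T x + sigma *: h, T y + sigma *: h))%:E
        <= (D * (w (x, y) + 2 * k * e))%:E)%E.
    move=> ex ey.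
    have -> : D * (w (x, y) + 2 * k * e) = D * (1 + k * (U x + e) + k * (U y + e)).
      by rewrite /w /=; ring.
    have := integral_weight_le D0 (ltW k_gt0) (mUT x) (mUT y) (fun h => U_ge0 _)
      (fun h => U_ge0 _) ex ey.
    apply: le_trans; rewrite le_eqVlt; apply/orP; left; apply/eqP.
    apply: eq_integral => h _; rewrite /W /w /D /=.
    by rewrite opprD addrACA subrr addr0.
  have w1 := w_ge1 (x, y); have wc := w_lec (x, y).
  have pc := pid_contr _ hd1 x y.
  have Kd0 : 0 < K_R' * delta by rewrite mulr_gt0.
  have [xyr|xyr] := pselect (enorm x <= r /\ enorm y <= r).
    case: xyr => xr yr.
    apply: le_trans (step (- (S * delta / 4)) (UTin _ _ ggam xr) (UTin _ _ ggam yr)) _.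
    have DC : D <= (1 + 3 * C_R * delta) * q2.
      apply: drift_contract_inner => //; rewrite ?(ltW delta_gt0) ?(ltW C_R_gt0)//.
      exact: b_lip_in.
    have -> : w (x, y) + 2 * k * - (S * delta / 4) = w (x, y) - 6 * C_R * delta.
      have -> : 2 * k * - (S * delta / 4) = - (k * S * delta / 2) by field.
      by rewrite kS; field.
    rewrite lee_fin; apply: (@le_trans _ _ ((1 - lambda1 * delta) * W (x, y))); last first.
      by rewrite ler_wpM2r// lerD2l lerN2 ler_wpM2r// ltW.
    apply: (weight_step_inner (c := c)) => //;
      rewrite ?(ltW delta_gt0) ?(ltW C_R_gt0) ?(ltW l1_gt0)//.
      by move: le_l1; rewrite ler_pdivlMr// mulrC.
    exact: le_trans w1.
  have xyr' : r < enorm x \/ r < enorm y.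
    have [xr|] := leP (enorm x) r; last by left.
    by right; rewrite ltNge; apply/negP => yr; apply: xyr.
  apply: le_trans (step _ (UT _ _ ggam) (UT _ _ ggam)) _.
  have B0 : 0 <= K_R * delta `^ (- theta) by rewrite mulr_ge0 ?powR_ge0// ltW.
  have DC : D <= (1 - K_R' * delta) * q2.
    apply: (drift_contract_outer (ltW delta_gt0) dK
      (step_size_lip delta_gt0 K_R'_gt0 K_R_gt0 th1 le_KR)) => //.
    - exact: b_lip_out.
    - exact: b_diss.
  (* Curvature accounts for 1/4 and drift for 1/2 of the factor 3/4. *)
  have -> : w (x, y) + 2 * k * (S * K_R' * delta / (32 * C_R)) =
      w (x, y) + 3 / 4 * (K_R' * delta).
    have -> : 2 * k * (S * K_R' * delta / (32 * C_R)) =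
        k * S * (K_R' * delta / (16 * C_R)) by field; rewrite Cn0.
    by rewrite kS; field; rewrite Cn0.
  rewrite lee_fin; apply: (@le_trans _ _ ((1 - lambda2 * delta) * W (x, y))); last first.
    by rewrite ler_wpM2r// lerD2l lerN2 ler_wpM2r// ltW.
  have -> : lambda2 * delta = K_R' * delta / 4 by rewrite /lambda2 mulrAC.
  by apply: weight_step_outer => //; exact: ltW.
apply: (W2_contraction delta_gt0 (mpid _ hd1) (mbd _ hd1) kappa_ge0 mW W_ge0 W_step
  _ _ lmu lnu (c := c)) => //.
- by move=> z; rewrite /W ler_peMr ?sqr_ge0.
- by move=> z; rewrite /W mulrC ler_wpM2r ?sqr_ge0.
- exact: ltW.
- by rewrite mulr_gt0 ?expR_gt0// /C0 powR_gt0// -cE.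
(* After removing [c = C0 ^+ 2], it remains to compare [kappa ^+ n] with the exponential, by 1 + x
   <= exp(x) at x = - lam delta. *)
rewrite exprMn C0sq mulrC ler_pM2l// -expRM_natl -/lam.
have -> : 2%:R * (- (1 / 2) * lam * n%:R * delta) = n%:R * (- (lam * delta)) by field.
rewrite expRM_natl lerXn2r ?nnegrE ?expR_ge0//.
exact: expR_ge1Dx.
Qed.
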